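(* Let $M\subseteq\mathcal B(H)$ be a finite-dimensional von Neumann algebra, and let $S\subseteq\mathcal B(H)$ be a quantum relation over $M$ with $S=S^*$. The following are equivalent: (1) there is a von Neumann algebra $N$ and a normal completely positive map $\theta\colon N\to M$ with $S=(V^{\theta})^*\circ V^\theta$; (2) there is $x_0\ge0$ in $S\cap M$ such that for every $x=x^*\in S$ there is $t>0$ with $-tx_0\le x\le tx_0$. In this case, we can take $x_0=\theta(1)$, and we may take $N$ to be finite-dimensional.
   Context: A quantum relation from $M\subseteq\mathcal B(H)$ to $N\subseteq\mathcal B(K)$ is a weak$^*$-closed subspace $V\subseteq\mathcal B(H,K)$ with $axb\in V$ whenever $x\in V,a\in N',b\in M'$; a quantum relation over $M$ is a quantum relation from $M$ to $M$. $V^*=\{v^*:v\in V\}$, and $V\circ W$ is the weak$^*$-closed linear span of $\{vw:v\in V,w\in W\}$. For a normal completely positive map $\theta\colon N\to M$, with $N\subseteq\mathcal B(K)$, choose a Hilbert space $L$ and $v\in\mathcal B(H,K\otimes L)$ with $\theta(y)=v^*(y\otimes1)v$ for $y\in N$; then $V^\theta\subseteq\mathcal B(H,K)$ is the weak$^*$-closed linear span of $\{y'(1\otimes\langle\xi|)v:\xi\in L,y'\in N'\}$, where $\langle\xi|\colon L\to\mathbb C,\eta\mapsto(\xi|\eta)$; it is a quantum relation from $M$ to $N$ independent of the choice of $(L,v)$. *)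

(* Defs.v *)
From HB Require Import structures.
From mathcomp Require Import all_boot all_order all_algebra.
From mathcomp Require Import complex.
From mathcomp Require Import all_classical all_reals all_analysis.

Set Implicit Arguments.
Unset Strict Implicit.
Unset Printing Implicit Defensive.

Import Order.TTheory GRing.Theory Num.Theory.
Import numFieldNormedType.Exports.

Local Open Scope classical_set_scope.
Local Open Scope ring_scope.
Local Open Scope complex_scope.

(* Complex Hilbert spaces. The inner product is linear in its second          *)
(* argument. Positive definiteness follows from [inner_norm].                 *)
HB.mixin Record isHilbert (R : realType) V & CompleteNormedModule R[i] V := {
  inner : V -> V -> R[i];
  inner_linear : forall (x : V) (a : R[i]) (y z : V),
    inner x (a *: y + z) = a * inner x y + inner x z;
  inner_conj : forall x y : V, inner y x = (inner x y)^*;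
  inner_norm : forall x : V, inner x x = `|x| ^+ 2
}.

#[short(type="hilbertType")]
HB.structure Definition Hilbert (R : realType) :=
  {V of isHilbert R V & CompleteNormedModule R[i] V}.

Section BoundedOperators.
Context {R : realType} (H K : hilbertType R).

Definition bounded_linear (f : H -> K) : Prop :=
  linear f /\ exists c : R, forall x, `|f x| <= c%:C * `|x|.

Definition bounded_linear_pred : {pred H -> K} :=
  [pred f | `[< bounded_linear f >]].

Lemma bounded_linear_submod : submod_closed bounded_linear_pred.
Proof.
split.
  rewrite inE; split; first by move=> a x y; rewrite scaler0 addr0.
  by exists 0 => x; rewrite normr0 mul0r.
move=> a f g; rewrite !inE => -[lf [c hc]] [lg [d hd]]; split.
  move=> b x y /=; rewrite !fctE lf lg !scalerDr !scalerA [b * a]mulrC.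
  by rewrite addrACA.
exists (complex.Re `|a| * c + d) => x.
rewrite !fctE; apply: le_trans (ler_normD _ _) _.
rewrite rmorphD rmorphM /= mulrDl lerD// normrZ -mulrA.
have -> : (complex.Re `|a|)%:C = `|a| by rewrite RRe_real// normr_real.
exact: ler_wpM2l.
Qed.

HB.instance Definition _ := GRing.isSubmodClosed.Build R[i] (H -> K)
  bounded_linear_pred bounded_linear_submod.

End BoundedOperators.
Arguments bounded_linear_pred {R} H K.

(* B(H, K), as a sub-lmodule of the functions from H to K *)
Record bop (R : realType) (H K : hilbertType R) := Bop {
  bop_fun :> H -> K;
  bop_mem : bop_fun \in bounded_linear_pred H K
}.

HB.instance Definition _ (R : realType) (H K : hilbertType R) :=
  [isSub for @bop_fun R H K].
HB.instance Definition _ (R : realType) (H K : hilbertType R) :=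
  [Choice of bop H K by <:].
HB.instance Definition _ (R : realType) (H K : hilbertType R) :=
  [SubChoice_isSubLmodule of bop H K by <:].

(* The predual of B(H, K), through its standard description: the normal       *)
(* functionals are T |-> \sum_n <eta_n, T xi_n> with (xi_n) and (eta_n)       *)
(* square-summable. This needs no separability, since a trace-class operator  *)
(* is a norm-convergent countable sum of rank-one operators.                  *)
Section WeakStar.
Context {R : realType}.

Definition square_summable (H : hilbertType R) (xi : nat -> H) : Prop :=
  cvgn (series (fun n => `|xi n| ^+ 2 : R[i]^o)).

Definition normal_functional (H K : hilbertType R) (w : bop H K -> R[i]^o) :=
  exists (xi : nat -> H) (eta : nat -> K),
    [/\ square_summable xi, square_summable eta &
      forall T : bop H K,
        series (fun n => inner (eta n) (T (xi n)) : R[i]^o) @ \oo --> w T].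

Definition predual (H K : hilbertType R) :=
  {w : bop H K -> R[i]^o | normal_functional w}.

Definition predual_eval (H K : hilbertType R) (T : bop H K) :
  {ptws predual H K -> R[i]^o} := fun w => sval w T.

End WeakStar.

(* [bop H K] carries the weak-star (sigma-weak) topology, so that [closed],   *)
(* [continuous], etc. refer to it.                                            *)
HB.instance Definition _ (R : realType) (H K : hilbertType R) :=
  Topological.copy (bop H K) (initial_topology (@predual_eval R H K)).

Section ClosedSpan.
Context {R : realType} {E : preTopologicalLmodType R[i]}.

Definition subspace_set (V : set E) : Prop :=
  V 0 /\ forall (a : R[i]) x y, V x -> V y -> V (a *: x + y).

Definition closed_subspace (V : set E) : Prop := subspace_set V /\ closed V.

Definition closed_span (A : set E) : set E := smallest closed_subspace A.

End ClosedSpan.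

Section Operators.
Context {R : realType}.

Lemma bid_subproof (H : hilbertType R) :
  (id : H -> H) \in bounded_linear_pred H H.
Proof. by rewrite inE; split => //; exists 1 => x; rewrite mul1r. Qed.

Definition bid (H : hilbertType R) : bop H H := Bop (bid_subproof H).

Lemma bcomp_subproof (H K L : hilbertType R) (x : bop K L) (y : bop H K) :
  (x \o y : H -> L) \in bounded_linear_pred H L.
Proof.
have := bop_mem x; have := bop_mem y; rewrite !inE.
move=> -[ly [d hd]] [lx [c hc]]; split.
  by move=> a u v /=; rewrite ly lx.
exists (`|c| * d) => u /=.
have hc' v : `|x v| <= `|c|%:C * `|v|.
  by apply: le_trans (hc v) _; rewrite ler_wpM2r// lecR ler_norm.
apply: le_trans (hc' _) _; rewrite rmorphM /= -mulrA ler_wpM2l//.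
by rewrite -[0]/(0%:C) lecR.
Qed.

Definition bcomp (H K L : hilbertType R) (x : bop K L) (y : bop H K) :
  bop H L := Bop (bcomp_subproof x y).

End Operators.

Notation "x \ob y" := (bcomp x y) (at level 40, left associativity).

Section VonNeumann.
Context {R : realType}.

(* [is_adjoint v w] means w = v^* *)
Definition is_adjoint (H K : hilbertType R) (v : bop H K) (w : bop K H) :=
  forall (x : H) (y : K), inner y (v x) = inner (w y) x.

Definition adj_set (H K : hilbertType R) (V : set (bop H K)) : set (bop K H) :=
  [set w | exists2 v, V v & is_adjoint v w].

Definition comp_set (H K L : hilbertType R)
    (V : set (bop K L)) (W : set (bop H K)) : set (bop H L) :=
  closed_span [set v \ob w | v in V & w in W].

Definition self_adjoint (H : hilbertType R) (x : bop H H) := is_adjoint x x.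

(* The order of [R[i]] makes 0 <= z imply that z is real, so this is the      *)
(* operator order x <= y.                                                     *)
Definition op_le (H : hilbertType R) (x y : bop H H) : Prop :=
  forall h : H, 0 <= inner h ((y - x) h).

Definition von_neumann (H : hilbertType R) (M : set (bop H H)) : Prop :=
  [/\ closed_subspace M, M (bid H),
      forall x y, M x -> M y -> M (x \ob y) &
      forall x w, M x -> is_adjoint x w -> M w].

Definition finite_dim (H : hilbertType R) (M : set (bop H H)) : Prop :=
  exists (n : nat) (b : 'I_n -> bop H H),
    M = [set \sum_i c i *: b i | c in [set: 'I_n -> R[i]]].

Definition commutant (H : hilbertType R) (M : set (bop H H)) : set (bop H H) :=
  [set a | forall x, M x -> a \ob x = x \ob a].

(* quantum relations from M to N *)
Definition quantum_relation (H K : hilbertType R) (M : set (bop H H))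
    (N : set (bop K K)) (V : set (bop H K)) : Prop :=
  closed_subspace V /\
  forall a x b, commutant N a -> V x -> commutant M b -> V (a \ob x \ob b).

(* Maps theta : N -> M are represented by functions on B(K) of which only the *)
(* restriction to N matters.                                                  *)
Section CPMaps.
Context (H K : hilbertType R) (N : set (bop K K)) (M : set (bop H H)).
Context (theta : bop K K -> bop H H).

Definition linear_on : Prop :=
  forall (c : R[i]) x y, N x -> N y ->
    theta (c *: x + y) = c *: theta x + theta y.

(* A matrix (a_ij) over N is positive iff it is a positive operator on K^n.   *)
Definition completely_positive : Prop :=
  forall (n : nat) (a : 'I_n -> 'I_n -> bop K K),
    (forall i j, N (a i j)) ->
    (forall k : 'I_n -> K, 0 <= \sum_i \sum_j inner (k i) (a i j (k j))) ->
    forall h : 'I_n -> H, 0 <= \sum_i \sum_j inner (h i) (theta (a i j) (h j)).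

Definition normal_cp : Prop :=
  [/\ forall y, N y -> M (theta y), linear_on, completely_positive &
      {within N, continuous theta}].

End CPMaps.

(* T, with the bilinear map tau, is the Hilbert space tensor product of K     *)
(* and L (unique up to a unitary).                                            *)
Record hilbert_tensor (K L T : hilbertType R) (tau : K -> L -> T) : Prop := {
  tensor_linearl : forall l, linear (tau^~ l);
  tensor_linearr : forall k, linear (tau k);
  tensor_inner : forall k k' l l',
    inner (tau k l) (tau k' l') = inner k k' * inner l l';
  tensor_total : closed_span [set tau k l | k in setT & l in setT] = setT
}.

(* Y = y \otimes 1 *)
Definition is_ampliation (K L T : hilbertType R) (tau : K -> L -> T)
    (y : bop K K) (Y : bop T T) : Prop :=
  forall k l, Y (tau k l) = tau (y k) l.

(* P = 1 \otimes <xi| *)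
Definition is_slice (K L T : hilbertType R) (tau : K -> L -> T)
    (xi : L) (P : bop T K) : Prop :=
  forall k l, P (tau k l) = inner xi l *: k.

Definition stinespring (H K L T : hilbertType R) (tau : K -> L -> T)
    (N : set (bop K K)) (theta : bop K K -> bop H H) (v : bop H T) : Prop :=
  exists2 w : bop T H, is_adjoint v w &
    forall y, N y ->
      exists2 Y : bop T T, is_ampliation tau y Y & theta y = w \ob Y \ob v.

(* [cp_relation N theta V] means V = V^theta, for some choice of (L, v); the  *)
(* relation V^theta does not depend on that choice.                           *)
Definition cp_relation (H K : hilbertType R) (N : set (bop K K))
    (theta : bop K K -> bop H H) (V : set (bop H K)) : Prop :=
  exists (L T : hilbertType R) (tau : K -> L -> T) (v : bop H T),
    [/\ hilbert_tensor tau, stinespring tau N theta v &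
      V = closed_span [set x | exists (y' : bop K K) (xi : L) (P : bop T K),
        [/\ commutant N y', is_slice tau xi P & x = y' \ob P \ob v]]].

(* theta : N -> M is normal CP and S = (V^theta)^* \o V^theta *)
Definition arises_from (H K : hilbertType R) (M S : set (bop H H))
    (N : set (bop K K)) (theta : bop K K -> bop H H) : Prop :=
  [/\ von_neumann N, normal_cp N M theta &
    exists2 V : set (bop H K), cp_relation N theta V &
      S = comp_set (adj_set V) V].

Definition dominating (H : hilbertType R) (M S : set (bop H H))
    (x0 : bop H H) : Prop :=
  [/\ op_le 0 x0, (S `&` M) x0 &
    forall x, S x -> self_adjoint x ->
      exists2 t : R, 0 < t & op_le (- (t%:C *: x0)) x /\ op_le x (t%:C *: x0)].

End VonNeumann.

(* Main.v *)
From HB Require Import structures.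
From mathcomp Require Import all_boot all_order all_algebra.
From mathcomp Require Import complex.
From mathcomp Require Import all_classical all_reals all_analysis.
From mathcomp Require Import ring lra.
Require Import Defs.

(** The proof uses two ideas, one for each implication.

    From a completely positive map to domination. If theta is implemented by v,
    then x0 = theta(1) is v^* v. Slicing T = K (x) L along finitely many vectors
    of L compresses v^* v to elements of V^* o V, and letting the slices exhaust
    L gives x0 in S ([slices_total]). As M is finite-dimensional, x0 satisfies a
    polynomial equation, hence x0 z x0 = x0 for some bounded z
    ([finite_dim_regular]). So p = z x0 fixes every element of V on the right;
    being weak-star closed, this condition extends to S. For x = x^* in S
    it gives <h, x h> = <p h, x p h>, which is at most a constant times
    |x0 h|^2, hence at most a constant times <h, x0 h> ([arises_dominating]).

    From domination to a completely positive map. The domination hypothesis says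
    that S is spanned by its positive elements, since x = (x + t x0) - t x0.
    The trace of left multiplication on M provides a finite family f_k in M for
    which E(A) = sum_k f_k^* A f_k maps B(H) into M' with E(1) = 1
    ([averaging]). For y >= 0 in S the operators
    E(|xi><a|) y E(|a><eta|) belong to S, and over all y their weak-star closed
    span is S, because rank-one operators are weak-star total and E(1) = 1.
    Expanding,
      E(|xi><a|) y E(|a><eta|) = sum_(k,l) X_kl f_k^* |xi><eta| f_l,
      X_kl = <f_k^* a, y f_l^* a>,
    so all the information on y and a is in a positive matrix X of fixed size.
    Finitely many of these matrices span all of them, and factoring each one as
    a Gram matrix yields finitely many completely positive maps
    |xi><eta| |-> sum_j g_ij^* |xi><eta| g_ij with g_ij in M whose ranges span S
    ([kraus_span]). These g_ij are the coefficients of v : H -> K (x) H, where K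
    has one basis vector for each pair (i, j). Let N be the algebra of matrices
    on K that are block-diagonal with respect to i. Then
    theta(y) = sum_(p,q) y_pq g_p^* g_q takes its values in M, and since N'
    consists of the block scalars, the products of elements of V^theta recover
    exactly the ranges above, block by block ([kraus_arises]).

    The Hilbert space tools needed on the way are the Riesz representation
    theorem, which gives adjoints and slices, and a Gram-Schmidt process for
    forms that may be degenerate ([parseval_frame]). The latter serves to build
    finite-rank projections, to factor positive matrices, and to find bases of M
    that are orthonormal for a given trace. *)

Set Implicit Arguments.
Unset Strict Implicit.
Unset Printing Implicit Defensive.

Import Order.TTheory GRing.Theory Num.Theory.
Import numFieldNormedType.Exports.

Local Open Scope classical_set_scope.
Local Open Scope ring_scope.
Local Open Scope complex_scope.

Local Notation "z ^J" := (conjc z) (at level 2, format "z ^J").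

(** * Degenerate inner products *)

Section ConjLemmas.
Context {R : realType}.
Implicit Types a b : R[i].
Lemma conjcD a b : conjc (a + b) = conjc a + conjc b.
Proof. exact: rmorphD. Qed.
Lemma conjcN a : conjc (- a) = - conjc a.
Proof. exact: rmorphN. Qed.
Lemma conjcM a b : conjc (a * b) = conjc a * conjc b.
Proof. exact: rmorphM. Qed.
Lemma conjc_sum (I : Type) (r : seq I) (P : pred I) (F : I -> R[i]) :
  conjc (\sum_(i <- r | P i) F i) = \sum_(i <- r | P i) conjc (F i).
Proof. exact: rmorph_sum. Qed.

Lemma conjc_ge0 a : 0 <= a -> conjc a = a.
Proof. by move=> /ger0_real /complex_realP[k ->]; rewrite conjc_real. Qed.

Lemma mulcJr a : conjc a * a = `|a| ^+ 2.
Proof. by rewrite sqr_normc mulrC. Qed.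
End ConjLemmas.

Section SemiInner.
Context {R : realType} {V : lmodType R[i]}.
Implicit Types B : V -> V -> R[i].

(** Forms are allowed to be degenerate so that the same Gram-Schmidt process
    applies to positive matrices and to traces as well as to inner products. *)
Record semi_inner B : Prop := SemiInner {
  semi_linear : forall x a y z, B x (a *: y + z) = a * B x y + B x z;
  semi_conj : forall x y, B y x = (B x y)^J;
  semi_ge0 : forall x, 0 <= B x x }.

Context (B : V -> V -> R[i]) (hB : semi_inner B).

Lemma semi0r x : B x 0 = 0.
Proof. by have := semi_linear hB x (-1) 0 0; rewrite scaler0 addr0 mulN1r addNr. Qed.
Lemma semiDr x y z : B x (y + z) = B x y + B x z.
Proof. by have := semi_linear hB x 1 y z; rewrite scale1r mul1r. Qed.
Lemma semiZr a x y : B x (a *: y) = a * B x y.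
Proof. by have := semi_linear hB x a y 0; rewrite semi0r !addr0. Qed.
Lemma semiNr x y : B x (- y) = - B x y.
Proof. by rewrite -scaleN1r semiZr mulN1r. Qed.
Lemma semiBr x y z : B x (y - z) = B x y - B x z.
Proof. by rewrite semiDr semiNr. Qed.
Lemma semi_sumr (I : Type) (r : seq I) (P : pred I) x (F : I -> V) :
  B x (\sum_(i <- r | P i) F i) = \sum_(i <- r | P i) B x (F i).
Proof. exact: (big_morph (B x) (semiDr x) (semi0r x)). Qed.
Lemma semi0l y : B 0 y = 0.
Proof. by rewrite (semi_conj hB) semi0r conjc0. Qed.
Lemma semiDl x y z : B (x + y) z = B x z + B y z.
Proof.
by rewrite (semi_conj hB z (x + y)) semiDr conjcD -!(semi_conj hB).
Qed.
Lemma semiZl a x y : B (a *: x) y = a^J * B x y.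
Proof. by rewrite (semi_conj hB y (a *: x)) semiZr conjcM -(semi_conj hB). Qed.
Lemma semiNl x y : B (- x) y = - B x y.
Proof. by rewrite (semi_conj hB y (- x)) semiNr conjcN -(semi_conj hB). Qed.
Lemma semiBl x y z : B (x - y) z = B x z - B y z.
Proof. by rewrite semiDl semiNl. Qed.
Lemma semi_suml (I : Type) (r : seq I) (P : pred I) y (F : I -> V) :
  B (\sum_(i <- r | P i) F i) y = \sum_(i <- r | P i) B (F i) y.
Proof.
exact: (big_morph (B^~ y) (fun x z => semiDl x z y) (semi0l y)).
Qed.

(** If B y y = 0 then B (x - t y') (x - t y') is affine in the real parameter t
    for y' a multiple of y, so it can only stay nonnegative if its slope, a
    multiple of the squared modulus of B x y, vanishes. *)
Lemma semi_null x y : B y y = 0 -> B x y = 0.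
Proof.
move=> hy; apply/eqP; apply: contraT => nz.
pose b := B x y; have bn : `|b| ^+ 2 != 0 by rewrite expf_eq0 normr_eq0.
(* This value of t makes the form equal to -1. *)
pose t : R[i] := (B x x + 1) / (2 * `|b| ^+ 2).
have tJ : t^J = t.
  apply: conjc_ge0; apply: divr_ge0; last by rewrite mulr_ge0 ?exprn_ge0.
  by apply: addr_ge0; [exact: semi_ge0|exact: ler01].
have := semi_ge0 hB (x - (t * b^J) *: y).
rewrite semiBl !semiBr !semiZl !semiZr hy !mulr0 subr0.
rewrite conjcM tJ conjcK (semi_conj hB x y) -/b.
rewrite -!mulrA mulcJr [b * b^J]mulrC mulcJr.
rewrite (_ : _ - _ = -1) ?ler0N1//.
by rewrite /t; clear tJ t; move: (`|b| ^+ 2) bn => m bn; field.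
Qed.

Lemma semi_CS x y : `|B x y| ^+ 2 <= B x x * B y y.
Proof.
have := semi_ge0 hB y; rewrite le_eqVlt => /predU1P[h0|h0].
  by rewrite -h0 mulr0 (@semi_null x y)// normr0 expr0n.
set c := B y y in h0 *; set b := B x y.
have cJ : c^J = c by rewrite conjc_ge0// ltW.
have := semi_ge0 hB (c *: x - b^J *: y).
rewrite semiBl !semiBr !semiZl !semiZr -/c cJ conjcK (semi_conj hB x y) -/b.
rewrite (_ : _ - _ = c * (B x x * c - `|b| ^+ 2)); last first.
  rewrite sqr_normc; ring.
by rewrite pmulr_rge0// subr_ge0.
Qed.

(** The condition [subspace_set], in a module without topology. *)
Definition submod (W : set V) := W 0 /\ forall a x y, W x -> W y -> W (a *: x + y).

Lemma submod_sum (W : set V) (I : Type) (r : seq I) (P : pred I) (F : I -> V) :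
  submod W -> (forall i, P i -> W (F i)) -> W (\sum_(i <- r | P i) F i).
Proof.
move=> [W0 WD] h; apply: (big_ind W) => // x y Wx Wy.
by rewrite -[x]scale1r; apply: WD.
Qed.

Lemma submodZ (W : set V) a x : submod W -> W x -> W (a *: x).
Proof. by move=> [W0 WD] h; rewrite -[_ *: _]addr0; apply: WD. Qed.

Lemma submodD (W : set V) x y : submod W -> W x -> W y -> W (x + y).
Proof. by move=> [W0 WD] h; rewrite -[x]scale1r; apply: WD. Qed.

Lemma submodB (W : set V) x y : submod W -> W x -> W y -> W (x - y).
Proof. by move=> sW h hy; apply: submodD => //; rewrite -scaleN1r; apply: submodZ. Qed.

(** Gram-Schmidt. A residual vector of norm zero is orthogonal to everything by
    [semi_null], so it may be replaced by zero; only the Parseval identity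
    survives, and it is all that is used later. *)
Lemma parseval_frame (n : nat) (b : nat -> V) : exists e : nat -> V,
  (forall W : set V, submod W -> (forall i, (i < n)%N -> W (b i)) ->
     forall j, (j < n)%N -> W (e j)) /\
  (forall i, (i < n)%N -> forall y,
     B (b i) y = \sum_(j < n) B (b i) (e j) * B (e j) y).
Proof.
elim: n => [|n [e [eW eP]]]; first by exists b; split.
(* W0 is the subspace on which the frame built so far satisfies Parseval; it
   contains the frame itself. *)
have [W0 W0P] : exists W0 : set V, forall x,
    W0 x <-> forall y, B x y = \sum_(j < n) B x (e j) * B (e j) y.
  by eexists => x; split; exact.
have sW0 : submod W0.
  split=> [|a x z /W0P hx /W0P hz]; apply/W0P => y.
    by rewrite semi0l big1// => j _; rewrite semi0l mul0r.
  rewrite semiDl semiZl hx hz mulr_sumr -big_split /=; apply: eq_bigr => j _.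
  by rewrite semiDl semiZl mulrDl mulrA.
have eW0 j : (j < n)%N -> W0 (e j).
  by apply: eW => // i hi; apply/W0P => y; exact: eP.
(* r is the part of the new vector orthogonal to W0. *)
pose r := b n - \sum_(j < n) B (e j) (b n) *: e j.
have rW0 x : W0 x -> B x r = 0.
  move=> /W0P hx; rewrite /r semiBr (hx (b n)) semi_sumr; apply/eqP; rewrite subr_eq0.
  by apply/eqP/eq_bigr => j _; rewrite semiZr mulrC.
pose c := B r r.
pose u : V := (sqrtc c)^-1 *: r.
have uu y : B r u * B u y = B r y.
  rewrite /u semiZr semiZl -/c.
  have sJ : (sqrtc c)^-1^J = (sqrtc c)^-1.
    by rewrite conjc_ge0// invr_ge0 sqrtc_ge0 semi_ge0.
  rewrite sJ; have [c0|c0] := eqVneq c 0.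
    have -> : B r y = 0.
      by rewrite (semi_conj hB y) semi_null ?conjc0.
    by rewrite !mulr0.
  rewrite mulrCA mulrA mulrA -expr2 exprVn sqr_sqrtc mulVf ?mul1r//.
exists (fun j => if j == n then u else e j); split=> [W sW Wb j|i].
  have rW : forall j, (j < n)%N -> W (e j).
    by apply: eW => // k kn; apply: Wb; rewrite ltnS ltnW.
  case: eqP => [_ _|/eqP jn]; last by rewrite ltnS leq_eqVlt (negbTE jn) /=; exact: rW.
  apply: submodZ => //; apply: submodB => //; first exact: Wb.
  by apply: submod_sum => // k _; apply: submodZ => //; exact: rW.
move=> hi y; rewrite big_ord_recr /= eqxx.
under eq_bigr => j _ do rewrite ltn_eqF//.
move: hi; rewrite ltnS leq_eqVlt => /predU1P[->|hi]; last first.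
  have bW : W0 (b i) by apply/W0P => z; exact: eP.
  by rewrite -(eP i hi) {2}/u semiZr (rW0 _ bW) mulr0 mul0r addr0.
have -> : b n = r + \sum_(j < n) B (e j) (b n) *: e j by rewrite subrK.
set s := \sum_(j < n) B (e j) (b n) *: e j.
have sW : W0 s.
  by apply: submod_sum => // k _; apply: submodZ => //; exact: eW0 (ltn_ord k).
rewrite semiDl [B (r + s) u]semiDl [B s u](_ : _ = 0) ?addr0; last first.
  by rewrite /u semiZr rW0// mulr0.
rewrite uu addrC (W0P s).1//; congr (_ + _); apply: eq_bigr => j _.
rewrite semiDl [B r _](_ : _ = 0) ?add0r//.
by rewrite (semi_conj hB (e j)) rW0 ?conjc0//; exact: (eW0 j (ltn_ord j)).
Qed.

End SemiInner.


(** * Riesz representation *)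

Section HilbertBasics.
Context {R : realType}.

Lemma inner_semi (H : hilbertType R) : semi_inner (@inner R H).
Proof.
split; [exact: inner_linear|exact: inner_conj|].
by move=> x; rewrite inner_norm exprn_ge0.
Qed.

Section One.
Context {H : hilbertType R}.
Implicit Types x y z : H.

Lemma inner0r x : inner x 0 = 0. Proof. exact: (semi0r (inner_semi H)). Qed.
Lemma inner0l x : inner 0 x = 0. Proof. exact: (semi0l (inner_semi H)). Qed.
Lemma innerDr x y z : inner x (y + z) = inner x y + inner x z.
Proof. exact: (semiDr (inner_semi H)). Qed.
Lemma innerDl x y z : inner (x + y) z = inner x z + inner y z.
Proof. exact: (semiDl (inner_semi H)). Qed.
Lemma innerBr x y z : inner x (y - z) = inner x y - inner x z.
Proof. exact: (semiBr (inner_semi H)). Qed.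
Lemma innerBl x y z : inner (x - y) z = inner x z - inner y z.
Proof. exact: (semiBl (inner_semi H)). Qed.
Lemma innerZr a x y : inner x (a *: y) = a * inner x y.
Proof. exact: (semiZr (inner_semi H)). Qed.
Lemma innerZl a x y : inner (a *: x) y = a^J * inner x y.
Proof. exact: (semiZl (inner_semi H)). Qed.
Lemma innerNr x y : inner x (- y) = - inner x y.
Proof. exact: (semiNr (inner_semi H)). Qed.
Lemma innerNl x y : inner (- x) y = - inner x y.
Proof. exact: (semiNl (inner_semi H)). Qed.
Lemma inner_sumr (I : Type) (r : seq I) (P : pred I) x (F : I -> H) :
  inner x (\sum_(i <- r | P i) F i) = \sum_(i <- r | P i) inner x (F i).
Proof. exact: (semi_sumr (inner_semi H)). Qed.
Lemma inner_suml (I : Type) (r : seq I) (P : pred I) x (F : I -> H) :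
  inner (\sum_(i <- r | P i) F i) x = \sum_(i <- r | P i) inner (F i) x.
Proof. exact: (semi_suml (inner_semi H)). Qed.
Lemma inner_ge0 x : 0 <= inner x x. Proof. exact: (semi_ge0 (inner_semi H)). Qed.
Lemma inner_eq0 x : inner x x = 0 -> x = 0.
Proof. by rewrite inner_norm => /eqP; rewrite sqrf_eq0 normr_eq0 => /eqP. Qed.
Lemma inner_sep x : (forall y, inner y x = 0) -> x = 0.
Proof. by move=> h; apply: inner_eq0. Qed.
Lemma inner_inj x y : (forall z, inner z x = inner z y) -> x = y.
Proof.
by move=> h; apply/eqP; rewrite -subr_eq0; apply/eqP/inner_sep => z; rewrite innerBr h subrr.
Qed.

Lemma inner_le x y : `|inner x y| <= `|x| * `|y|.
Proof.
rewrite -(@ler_pXn2r _ 2)// ?nnegrE ?mulr_ge0//.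
by rewrite exprMn -!inner_norm; exact: (semi_CS (inner_semi H)).
Qed.

End One.

Lemma Re_ge0 (z : R[i]) : 0 <= z -> 0 <= complex.Re z.
Proof. by rewrite lecE => /andP[]. Qed.

Lemma Re_le (z w : R[i]) : z <= w -> complex.Re z <= complex.Re w.
Proof. by rewrite lecE => /andP[]. Qed.

Lemma Re_D (z w : R[i]) : complex.Re (z + w) = complex.Re z + complex.Re w.
Proof. by case: z w => [a b] [c d]. Qed.
Lemma Re_N (z : R[i]) : complex.Re (- z) = - complex.Re z.
Proof. by case: z. Qed.
Lemma Re_Cmul (r : R) (z : R[i]) : complex.Re (r%:C * z) = r * complex.Re z.
Proof. by case: z => a b /=; rewrite mul0r subr0. Qed.
Lemma Re_J (z : R[i]) : complex.Re (z^J) = complex.Re z.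
Proof. by case: z. Qed.
Lemma Re_norm (z : R[i]) : - complex.Re `|z| <= complex.Re z.
Proof.
have /Re_le /= h := normc_ge_Re z.
by rewrite lerNl (le_trans _ h)// -normrN ler_norm.
Qed.

Lemma Re_C (a : R) : complex.Re (a%:C) = a. Proof. by []. Qed.
Lemma CrM (a b : R) : (a * b)%:C = a%:C * b%:C. Proof. exact: rmorphM. Qed.
Lemma CrN (a : R) : (- a)%:C = - a%:C. Proof. exact: rmorphN. Qed.
Lemma CrX (a : R) n : (a ^+ n)%:C = a%:C ^+ n. Proof. exact: rmorphXn. Qed.
Lemma Re_normX (z : R[i]) n : (complex.Re (`|z| ^+ n))%:C = `|z| ^+ n.
Proof. by rewrite RRe_real// rpredX// ger0_real. Qed.

Section Riesz.
Context {H : hilbertType R} (f : H -> R[i]) (c : R).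
Hypothesis f_lin : forall a x y, f (a *: x + y) = a * f x + f y.
Hypothesis f_bnd : forall x, `|f x| <= c%:C * `|x|.

Let fD x y : f (x + y) = f x + f y.
Proof. by rewrite -[x]scale1r f_lin mul1r scale1r. Qed.
Let f0 : f 0 = 0.
Proof. by have /eqP := fD 0 0; rewrite addr0 -subr_eq subrr => /eqP. Qed.
Let fZ a x : f (a *: x) = a * f x.
Proof. by rewrite -[a *: x]addr0 f_lin f0 addr0. Qed.

(* The representing vector is the minimiser of this functional; it exists because
   J is bounded below, and by the parallelogram law the sets where J is close to
   its infimum form a Cauchy filter. *)
Let J x : R := complex.Re (inner x x) - 2 * complex.Re (f x).

Let J_lb x : - c ^+ 2 <= J x.
Proof.
have h1 := f_bnd x.
pose r := complex.Re `|x|; have rE : `|x| = r%:C.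
  by rewrite /r RRe_real// ger0_real.
have h2 : complex.Re (f x) <= c * r.
  have := Re_le h1; rewrite rE Re_Cmul /=; apply: le_trans.
  by have := Re_norm (- f x); rewrite normrN Re_N lerN2.
rewrite /J inner_norm rE -rmorphXn /=.
move: (complex.Re (f x)) h2 => u h2; have := sqr_ge0 (r - c).
rewrite sqrrB => h3; lra.
Qed.

Let JD x h : J (x + h) =
  J x + complex.Re (inner h h) + 2 * complex.Re (inner x h - f h).
Proof.
rewrite /J fD innerDr !innerDl !Re_D Re_N (inner_conj x h) Re_J; ring.
Qed.

Let m : R := inf (range J).

Let J_ge x : m <= J x.
Proof.
apply: ge_inf; last by exists x.
by exists (- c ^+ 2) => _ [y _ <-]; exact: J_lb.
Qed.

Let J_lt (e : R) : 0 < e -> exists x, J x < m + e.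
Proof.
move=> e0; have [] := @inf_adherent _ (range J) e e0.
  split; first by exists (J 0), 0.
  by exists (- c ^+ 2) => _ [y _ <-]; exact: J_lb.
by move=> _ [x _ <-] h; exists x.
Qed.

Let half_sum x y : J x + J y =
  2 * J (2^-1%:C *: (x + y)) + 2^-1 * complex.Re (inner (x - y) (x - y)).
Proof.
rewrite /J fZ fD innerBr !innerBl innerZr innerZl innerDr !innerDl conjc_real.
rewrite mulrA -rmorphM !(Re_Cmul, Re_D, Re_N) (inner_conj x y) Re_J.
by field.
Qed.

Let F : set_system H :=
  filter_from [set e : R | 0 < e] (fun e => [set x | J x < m + e]).

Let FF : ProperFilter F.
Proof.
apply: filter_from_proper; last by move=> e /= /J_lt[x hx]; exists x.
apply: filter_from_filter; first by exists 1 => /=.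
move=> e d /= e0 d0; exists (Num.min e d); first by rewrite /= lt_min e0.
by move=> x /= hx; split; apply: (lt_le_trans hx); rewrite lerD2l ge_min lexx ?orbT.
Qed.

Let near_min (x y : H) (e : R) : J x < m + e -> J y < m + e ->
  inner (x - y) (x - y) <= (4 * e)%:C.
Proof.
move=> hx hy; have h := half_sum x y; have hm := J_ge (2^-1%:C *: (x + y)).
have := inner_ge0 (x - y); rewrite !lecE /= => /andP[/eqP h1 h2].
rewrite h1 eqxx /=; move: h hm hx hy; set a := complex.Re _; set b := J (_ *: _).
move=> h hm hx hy; lra.
Qed.

(** At a minimiser y the first-order variation of J, which is the real part of
    <y, h> - f h, is bounded below by a quadratic term in h; rescaling h by a
    small negative multiple of the conjugate of <y, h> - f h forces this number
    to be zero. *)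
Lemma riesz : exists y, forall x, f x = inner y x.
Proof.
have epsP (eps : R[i]) : 0 < eps -> exists2 e : R, 0 < e & eps = e%:C.
  by rewrite ltcE => /andP[/eqP h1 h2]; exists (complex.Re eps);
     rewrite // [LHS]complexE h1 mulr0 addr0.
have : cauchy F.
  apply/(@cauchyP _ _ F FF) => eps0 eps00.
  have [e e0 ->] := epsP _ eps00; clear eps0 eps00.
  have d0 : 0 < e ^+ 2 / 8 by rewrite divr_gt0// exprn_gt0.
  have [x hx] := J_lt d0; exists x; exists (e ^+ 2 / 8) => // y /= hy.
  rewrite -ball_normE /= -(@ltr_pXn2r _ 2)// ?nnegrE ?normr_ge0 ?ler0c ?(ltW e0)//.
  rewrite -inner_norm (le_lt_trans (near_min hx hy))// -rmorphXn /= ltcR.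
  by rewrite [ltLHS](_ : _ = e ^+ 2 / 2) ?ltr_pdivrMr ?ltr_pMr ?exprn_gt0// ?ltr1n//; field.
move=> /(@cauchy_cvg _ F FF) /cvg_ex[y Fy]; exists y.
pose g h := inner y h - f h.
have key h : 0 <= complex.Re (inner h h) + 2 * complex.Re (g h).
  apply/ler_addgt0Pr => e e0; rewrite -lerBlDr sub0r.
  have n0 : 0 < 4 * (complex.Re `|h| + 1).
    by rewrite mulr_gt0// ltr_wpDl// Re_ge0.
  have d0 : 0 < e / (4 * (complex.Re `|h| + 1)) by rewrite divr_gt0.
  have /Fy : nbhs y (ball y (e / (4 * (complex.Re `|h| + 1)))%:C).
    by apply: nbhsx_ballx; rewrite ltcR.
  move=> [d d0' hd].
  have [x hx] : exists x, J x < m + Num.min d (e / 2).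
    by apply: J_lt; rewrite lt_min d0' divr_gt0.
  have xd : ball y (e / (4 * (complex.Re `|h| + 1)))%:C x.
    by apply: hd => /=; apply: lt_le_trans hx _; rewrite lerD2l ge_min lexx.
  have {}hx : J x < m + e / 2.
    by apply: lt_le_trans hx _; rewrite lerD2l ge_min lexx orbT.
  have := J_ge (x + h); rewrite JD => hxh.
  have : complex.Re (inner (x - y) h) <= e / 4.
    have := Re_norm (- inner (x - y) h); rewrite normrN Re_N lerN2 => /le_trans; apply.
    have hE : `|h| = (complex.Re `|h|)%:C by rewrite RRe_real// ger0_real.
    have := Re_le (inner_le (x - y) h).
    rewrite [`|x - y| * _]mulrC hE Re_Cmul /= => /le_trans; apply.
    move: xd; rewrite -ball_normE /= distrC => /ltW/Re_le /= xd.
    have h0 : 0 <= complex.Re `|h| by rewrite Re_ge0.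
    apply: (@le_trans _ _ (complex.Re `|h| * (e / (4 * (complex.Re `|h| + 1))))).
      by rewrite ler_wpM2l.
    move: (complex.Re `|h|) h0 => r r0.
    have r1 : 0 < r + 1 by rewrite ltr_wpDl.
    rewrite mulrA ler_pdivrMr ?mulr_gt0//.
    rewrite (_ : e / 4 * _ = e * (r + 1)); last by field.
    by rewrite mulrC ler_pM2l// lerDl.
  move: hxh; rewrite /g innerBl !(Re_D, Re_N) => hxh hi; lra.
move=> h; apply/eqP; rewrite eq_sym -subr_eq0 -/(g h); apply: contraT => gn0.
have gZ a : g (a *: h) = a * g h by rewrite /g innerZr fZ mulrBr.
pose N := complex.Re (inner h h).
have N0 : 0 <= N by rewrite Re_ge0// inner_ge0.
pose s := (N + 1)^-1.
have s0 : 0 < s by rewrite invr_gt0 ltr_wpDl.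
have [G G0 GE] : exists2 G : R, 0 < G & `|g h| ^+ 2 = G%:C.
  have : 0 < `|g h| ^+ 2 by rewrite exprn_gt0// normr_gt0.
  rewrite ltcE => /andP[_]; exists (complex.Re (`|g h| ^+ 2)) => //.
  by rewrite Re_normX.
have := key (- (s%:C * (g h)^J) *: h).
rewrite innerZr innerZl gZ.
have -> : (- (s%:C * (g h)^J)) * ((- (s%:C * (g h)^J))^J * inner h h) =
    (s ^+ 2 * G)%:C * inner h h.
  rewrite CrM -GE CrX conjcN conjcM conjcK conjc_real sqr_normc; ring.
have -> : - (s%:C * (g h)^J) * g h = (- s * G)%:C.
  rewrite CrM -GE CrN -mulcJr; ring.
rewrite Re_Cmul Re_C -/N.
rewrite (_ : _ + _ = G * s * (s * N - 2)); last ring.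
rewrite pmulr_rge0 ?mulr_gt0// /s subr_ge0 mulrC ler_pdivlMr; last by rewrite ltr_wpDl.
move=> hh; exfalso; lra.
Qed.

End Riesz.
End HilbertBasics.


(** * Bounded operators and their adjoints *)

Section Bops.
Context {R : realType}.

Section Basic.
Context {H K : hilbertType R}.
Implicit Types x y : bop H K.

Lemma bopP x y : (forall h, x h = y h) -> x = y.
Proof. by move=> e; apply: val_inj; apply/funext. Qed.

Lemma bop_linear x : linear x.
Proof. by have := bop_mem x; rewrite inE => -[]. Qed.

HB.instance Definition _ (x : bop H K) :=
  GRing.isLinear.Build R[i] H K *:%R (x : H -> K) (bop_linear x).

Lemma bopDE x y h : (x + y) h = x h + y h. Proof. by []. Qed.
Lemma bopNE x h : (- x) h = - x h. Proof. by []. Qed.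
Lemma bopBE x y h : (x - y) h = x h - y h. Proof. by []. Qed.
Lemma bopZE a x h : (a *: x) h = a *: x h. Proof. by []. Qed.
Lemma bop_sumE (I : Type) (r : seq I) (P : pred I) (F : I -> bop H K) h :
  (\sum_(i <- r | P i) F i) h = \sum_(i <- r | P i) F i h.
Proof. exact: (big_morph (fun x : bop H K => x h)). Qed.

Lemma bop_bound x : exists2 c : R, 0 <= c & forall h, `|x h| <= c%:C * `|h|.
Proof.
have := bop_mem x; rewrite inE => -[_ [c hc]]; exists `|c| => // h.
by apply: le_trans (hc h) _; rewrite ler_wpM2r// lecR ler_norm.
Qed.

Lemma bop_exists (f : H -> K) : linear f ->
  (exists c : R, forall h, `|f h| <= c%:C * `|h|) ->
  exists x : bop H K, forall h, x h = f h.
Proof.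
move=> lf bf; have hf : f \in bounded_linear_pred H K by rewrite inE; split.
by exists (Bop hf).
Qed.

End Basic.

Lemma norm_inner_le (H : hilbertType R) (x : H) (c : R[i]) :
  0 <= c -> inner x x <= c * `|x| -> `|x| <= c.
Proof.
move=> c0; have [->|x0] := eqVneq x 0; first by rewrite normr0.
by rewrite inner_norm expr2 ler_pM2r// normr_gt0.
Qed.

(** The value of the adjoint at y represents the functional <y, v x>. *)
Lemma adj_exists (H K : hilbertType R) (v : bop H K) :
  exists w : bop K H, is_adjoint v w.
Proof.
have [c c0 hc] := bop_bound v.
have rz y : exists z, forall x, inner y (v x) = inner z x.
  apply: (@riesz _ _ _ (c * complex.Re `|y|)) => [a u w|x].
    by rewrite linearP innerDr innerZr.
  apply: le_trans (inner_le _ _) _.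
  rewrite CrM RRe_real ?ger0_real// mulrAC [_ * `|y|]mulrC.
  by rewrite ler_wpM2l.
have [f hf] := choice rz.
have [w hw] : exists w : bop K H, forall h, w h = f h.
  apply: bop_exists.
    move=> a y z; apply: inner_inj => x.
    rewrite inner_conj -hf (innerDl (a *: y)) innerZl !hf -innerZl -innerDl.
    by rewrite -inner_conj.
  exists c => y; apply: norm_inner_le; first by rewrite mulr_ge0// ler0c.
  rewrite -[leLHS]ger0_norm ?inner_ge0// -hf; apply: le_trans (inner_le _ _) _.
  by rewrite mulrAC mulrC ler_wpM2r.
by exists w => x y; rewrite hw hf.
Qed.

Definition adj (H K : hilbertType R) (v : bop H K) : bop K H :=
  projT1 (cid (adj_exists v)).

Section Adj.
Context {H K : hilbertType R}.
Implicit Types v x : bop H K.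

Lemma adjP v : is_adjoint v (adj v).
Proof. by rewrite /adj; case: cid. Qed.
Lemma adjl v (h : H) k : inner (adj v k) h = inner k (v h).
Proof. by rewrite adjP. Qed.
Lemma adjr v (h : H) k : inner h (adj v k) = inner (v h) k.
Proof. by rewrite inner_conj adjl -inner_conj. Qed.
Lemma adj_uniq v w : is_adjoint v w -> w = adj v.
Proof.
move=> h; apply: bopP => k; apply: inner_inj => z.
by rewrite adjr inner_conj -h -inner_conj.
Qed.
End Adj.

Lemma adjK (H K : hilbertType R) (v : bop H K) : adj (adj v) = v.
Proof. by apply/esym/adj_uniq => x y; rewrite adjr. Qed.

Lemma adjD (H K : hilbertType R) (v w : bop H K) : adj (v + w) = adj v + adj w.
Proof.
by apply/esym/adj_uniq => x y; rewrite bopDE innerDr innerDl !adjl.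
Qed.
Lemma adjZ (H K : hilbertType R) a (v : bop H K) : adj (a *: v) = a^J *: adj v.
Proof.
by apply/esym/adj_uniq => x y; rewrite bopZE innerZr innerZl conjcK adjl.
Qed.
Lemma adj0 (H K : hilbertType R) : adj (0 : bop H K) = 0.
Proof. by apply/esym/adj_uniq => x y; rewrite inner0r inner0l. Qed.
Lemma adjN (H K : hilbertType R) (v : bop H K) : adj (- v) = - adj v.
Proof.
by apply/esym/adj_uniq => x y; rewrite bopNE innerNr innerNl adjl.
Qed.
Lemma adj_sum (H K : hilbertType R) (I : Type) (r : seq I) (P : pred I) (F : I -> bop H K) :
  adj (\sum_(i <- r | P i) F i) = \sum_(i <- r | P i) adj (F i).
Proof. exact: (big_morph (@adj H K) (@adjD H K) (adj0 H K)). Qed.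
Lemma adj_comp (H K L : hilbertType R) (x : bop K L) (y : bop H K) :
  adj (x \ob y) = adj y \ob adj x.
Proof. by apply/esym/adj_uniq => h k /=; rewrite !adjl. Qed.
Section Comp.
Context {G H K L : hilbertType R}.

Lemma bcompA (x : bop K L) (y : bop H K) (z : bop G H) :
  x \ob (y \ob z) = x \ob y \ob z.
Proof. exact: bopP. Qed.
Lemma bcompDl (x x' : bop K L) (y : bop H K) : (x + x') \ob y = x \ob y + x' \ob y.
Proof. exact: bopP. Qed.
Lemma bcompDr (x : bop K L) (y y' : bop H K) : x \ob (y + y') = x \ob y + x \ob y'.
Proof. by apply: bopP => h; exact: (linearD x). Qed.
Lemma bcompZl a (x : bop K L) (y : bop H K) : (a *: x) \ob y = a *: (x \ob y).
Proof. exact: bopP. Qed.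
Lemma bcompZr a (x : bop K L) (y : bop H K) : x \ob (a *: y) = a *: (x \ob y).
Proof. by apply: bopP => h; exact: (linearZZ x). Qed.
Lemma bcomp0l (y : bop H K) : (0 : bop K L) \ob y = 0.
Proof. exact: bopP. Qed.
Lemma bcomp0r (x : bop K L) : x \ob (0 : bop H K) = 0.
Proof. by apply: bopP => h; exact: (linear0 x). Qed.
Lemma bcompNr (x : bop K L) (y : bop H K) : x \ob (- y) = - (x \ob y).
Proof. by apply: bopP => h; exact: (linearN x). Qed.
Lemma bcomp_suml (I : Type) (r : seq I) (P : pred I) (F : I -> bop K L) (y : bop H K) :
  (\sum_(i <- r | P i) F i) \ob y = \sum_(i <- r | P i) (F i \ob y).
Proof.
exact: (big_morph (fun x : bop K L => x \ob y) (fun x x' => bcompDl x x' y)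
  (bcomp0l y)).
Qed.
Lemma bcomp_sumr (I : Type) (r : seq I) (P : pred I) (x : bop K L) (F : I -> bop H K) :
  x \ob (\sum_(i <- r | P i) F i) = \sum_(i <- r | P i) (x \ob F i).
Proof. exact: (big_morph (bcomp x) (bcompDr x) (bcomp0r x)). Qed.
Lemma bcomp1l (x : bop H K) : bid K \ob x = x. Proof. exact: bopP. Qed.
Lemma bcomp1r (x : bop H K) : x \ob bid H = x. Proof. exact: bopP. Qed.
End Comp.

End Bops.


(** * The weak-star topology *)

Section ClosedSpan.
Context {R : realType} {E : preTopologicalLmodType R[i]}.
Implicit Types A V : set E.

Lemma closed_subspace_bigcap (I : Type) (P : set I) (F : I -> set E) :
  (forall i, P i -> closed_subspace (F i)) ->
  closed_subspace (\bigcap_(i in P) F i).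
Proof.
move=> h; split; last by apply: closed_bigI => i Pi; have [] := h i Pi.
split=> [i Pi|a x y hx hy i Pi]; have [[F0 FD] _] := h i Pi; first exact: F0.
by apply: FD; [exact: hx|exact: hy].
Qed.

Lemma closed_span_closed A : closed_subspace (closed_span A).
Proof. by apply: closed_subspace_bigcap => V []. Qed.

Lemma sub_closed_span A : A `<=` closed_span A.
Proof. exact: sub_gen_smallest. Qed.

Lemma closed_span_sub A V : closed_subspace V -> A `<=` V -> closed_span A `<=` V.
Proof. exact: smallest_sub. Qed.

Lemma subspace_submod V : subspace_set V = submod V. Proof. by []. Qed.

End ClosedSpan.

Section WeakStarLemmas.
Context {R : realType}.

Section One.
Context {H K : hilbertType R}.
Implicit Types (w : bop H K -> R[i]^o) (T S : bop H K).

(** The weak-star topology is the initial one for the normal functionals. *)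
Lemma weak_cvg (X : Type) (F : set_system X) (FF : Filter F) (f : X -> bop H K) T :
  (forall w, normal_functional w -> w (f x) @[x --> F] --> w T) ->
  f @ F --> T.
Proof.
move=> h.
have hp : {ptws, (@predual_eval R H K \o f) @ F --> predual_eval T}.
  apply/cvg_sup => i A [B [[C oC <-] CT] CA].
  have : nbhs (sval i T) C by apply: open_nbhs_nbhs.
  move/(h _ (svalP i)); rewrite /nbhs/= /nbhs/=; apply: filterS => x hx.
  exact: CA.
move=> U [B [[C oC <-] CT] CU].
have /hp : nbhs (predual_eval T) C by apply: open_nbhs_nbhs.
by rewrite /= /nbhs/=; apply: filterS => x hx; exact: CU.
Qed.

Lemma normal_continuous w : normal_functional w -> continuous w.
Proof.
move=> hw T; pose i : predual H K := exist _ w hw.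
have h1 : @predual_eval R H K @ nbhs T --> predual_eval T.
  exact: initial_continuous.
move=> A; rewrite nbhsE => -[C [oC CT] CA].
move/cvg_sup: h1 => /(_ i) h2.
have : nbhs T (@predual_eval R H K @^-1` ((fun f => f i) @^-1` C)).
  apply: h2; exists ((fun f : predual H K -> R[i]^o => f i) @^-1` C) => //.
  by split=> //; exists C.
by apply: filterS => S hS; exact: CA.
Qed.

Lemma normal_linear w a T S : normal_functional w ->
  w (a *: T + S) = a * w T + w S.
Proof.
move=> [xi [eta [_ _ h]]].
have h1 := h (a *: T + S).
have h2 : series (fun n => inner (eta n) ((a *: T + S) (xi n)) : R[i]^o) @ \oo
    --> (a *: (w T : R[i]^o) + w S : R[i]^o).
  rewrite (_ : series _ = a *: series (fun n => inner (eta n) (T (xi n)) : R[i]^o)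
    + series (fun n => inner (eta n) (S (xi n)) : R[i]^o)).
    by apply: cvgD; [apply: cvgZr; exact: h|exact: h].
  apply/funext => n; transitivity (
    a * series (fun n => inner (eta n) (T (xi n)) : R[i]^o) n +
    series (fun n => inner (eta n) (S (xi n)) : R[i]^o) n); last by [].
  rewrite /series /= mulr_sumr -big_split /=; apply: eq_bigr => k _.
  by rewrite -innerZr -innerDr.
exact: (cvg_unique (@norm_hausdorff _ _) h1 h2).
Qed.

Lemma normal0 w : normal_functional w -> w 0 = 0.
Proof.
move=> hw; have := normal_linear (-1) 0 0 hw.
by rewrite scaler0 addr0 mulN1r addNr.
Qed.

Lemma normalZ w a T : normal_functional w -> w (a *: T) = a * w T.
Proof.
by move=> hw; have := normal_linear a T 0 hw; rewrite normal0// !addr0.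
Qed.

Lemma normal_rank (h : H) (k : K) :
  normal_functional (fun T => inner k (T h) : R[i]^o).
Proof.
exists (fun n => if n is 0 then h else 0), (fun n => if n is 0 then k else 0).
have sum0 (f : nat -> R[i]^o) : (forall n, f n.+1 = 0) ->
    series f @ \oo --> f 0.
  move=> f0; apply: cvg_near_cst; exists 1%N => // n /= n0.
  rewrite /series /= -(prednK n0) big_nat_recl// big1 ?addr0// => i _.
split.
- apply/cvg_ex; eexists; apply: sum0 => n; rewrite normr0 expr0n//.
- apply/cvg_ex; eexists; apply: sum0 => n; rewrite normr0 expr0n//.
- by move=> T; apply: (sum0 (fun n => inner _ (T _) : R[i]^o)) => n; rewrite inner0l.
Qed.

Lemma closed_subspace_normal_ker w : normal_functional w ->
  closed_subspace [set T | w T = 0].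
Proof.
move=> hw; have w0 := normal0 hw.
split; first by split=> //= a x y hx hy; rewrite normal_linear// hx hy mulr0 addr0.
have := @preimage_closed _ _ w [set 0]; apply.
  by move=> x _; exact: normal_continuous.
exact: (accessible_closed_set1 (hausdorff_accessible (@norm_hausdorff _ _))).
Qed.

Lemma closed_subspace0 : closed_subspace [set (0 : bop H K)].
Proof.
rewrite (_ : [set _] = \bigcap_(p in [set: H * K])
    [set T : bop H K | inner p.2 (T p.1) = 0]).
  apply: closed_subspace_bigcap => p _.
  exact: (closed_subspace_normal_ker (normal_rank p.1 p.2)).
apply/seteqP; split=> [_ -> p _|T hT]; first exact: inner0r.
by apply: bopP => h; apply: inner_sep => k; exact: (hT (h, k)).
Qed.

End One.

(** Continuity is asked after composition with normal functionals, which makes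
    sums and compositions easy to handle without knowing that operator spaces
    are topological vector spaces. *)
Definition normal_map (H K H' K' : hilbertType R) (F : bop H K -> bop H' K') :=
  linear F /\
  forall w : bop H' K' -> R[i]^o, normal_functional w -> continuous (w \o F).

Section NormalMap.
Context {H K H' K' : hilbertType R}.
Implicit Types (F G : bop H K -> bop H' K').

Lemma normal_map_continuous F : normal_map F -> continuous F.
Proof.
move=> [_ h] T.
have := @weak_cvg _ _ _ (nbhs T) (nbhs_filter T) F (F T).
by apply => w hw; exact: (h w hw T).
Qed.

(** This lemma extends an inclusion from generators to weak-star closures: to
    prove F T in V for all T in a closed span, it suffices to check generators. *)
Lemma normal_map_preimage F V : normal_map F -> closed_subspace V ->
  closed_subspace (F @^-1` V).
Proof.
move=> nF [[V0 VD] cV]; have [lF _] := nF.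
have F0 : F 0 = 0.
  by have := lF (-1) 0 0; rewrite scaler0 addr0 scaleN1r addNr.
split; first split=> [|a x y hx hy]; rewrite /preimage /= ?F0 ?lF//.
  exact: VD.
by apply: preimage_closed cV => x _; exact: normal_map_continuous.
Qed.

Lemma normal_map_ker F : normal_map F -> closed_subspace [set T | F T = 0].
Proof. by move=> nF; have := normal_map_preimage nF closed_subspace0. Qed.

Lemma normal_mapD F G : normal_map F -> normal_map G ->
  normal_map (fun T => F T + G T).
Proof.
move=> [lF cF] [lG cG]; split=> [a x y|w hw].
  by rewrite lF lG scalerDr addrACA.
rewrite (_ : _ \o _ = (w \o F) + (w \o G)).
  by move=> T; apply: continuousD; [exact: cF|exact: cG].
apply/funext => T; rewrite fctE /=.
by have := normal_linear 1 (F T) (G T) hw; rewrite scale1r mul1r.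
Qed.

Lemma normal_map0 : normal_map (fun _ : bop H K => 0 : bop H' K').
Proof.
split=> [b x y|w hw]; first by rewrite scaler0 addr0.
rewrite (_ : _ \o _ = cst (w 0))//; exact: cst_continuous.
Qed.

Lemma normal_map_sum (I : Type) (r : seq I) (P : pred I)
    (F : I -> bop H K -> bop H' K') : (forall i, P i -> normal_map (F i)) ->
  normal_map (fun T => \sum_(i <- r | P i) F i T).
Proof.
move=> h; elim: r => [|i r IH].
  rewrite (_ : (fun T => _) = fun=> 0); first exact: normal_map0.
  by apply/funext => T; rewrite big_nil.
case: (boolP (P i)) => Pi; last first.
  rewrite (_ : (fun T => _) = (fun T => \sum_(i <- r | P i) F i T)) //.
  by apply/funext => T; rewrite big_cons (negbTE Pi).
rewrite (_ : (fun T => _) = (fun T => F i T + \sum_(i <- r | P i) F i T)).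
  exact: normal_mapD (h i Pi) IH.
by apply/funext => T; rewrite big_cons Pi.
Qed.

End NormalMap.

End WeakStarLemmas.


(** * The complex numbers as a Hilbert space *)

(** An alias, because [R[i]^o] and [R^o] share their head constant, and the
    completeness instance on the former would clash with the one on the latter. *)
Definition cplx (R : realType) : Type := R[i].

Section Cplx.
Context {R : realType}.

HB.instance Definition _ := NormedModule.copy (cplx R) (R[i]^o).

Lemma cplx_ball_Re (z w : R[i]) (e : R) : `|z - w| < e%:C ->
  `|complex.Re z - complex.Re w| < e.
Proof.
rewrite -ltcR; apply: le_lt_trans.
by have := normc_ge_Re (z - w); rewrite Re_D Re_N.
Qed.

Lemma pos_complexP (eps : R[i]) : 0 < eps -> exists2 e : R, 0 < e & eps = e%:C.
Proof.
rewrite ltcE => /andP[/eqP h1 h2]; exists (complex.Re eps) => //.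
by rewrite [LHS]complexE h1 mulr0 addr0.
Qed.

Lemma norm_i : `|'i%C : R[i]| = 1.
Proof. by rewrite normc_def /= expr0n /= add0r expr1n sqrtr1. Qed.

Lemma norm_complex_le (z : R[i]) :
  `|z| <= (`|complex.Re z| + `|complex.Im z|)%:C.
Proof.
rewrite [X in `|X|]complexE; apply: le_trans (ler_normD _ _) _.
rewrite rmorphD/= normrM norm_i mul1r; apply: lerD; last first.
  by rewrite normc_def/= expr0n/= addr0 sqrtr_sqr.
by rewrite normc_def/= expr0n/= addr0 sqrtr_sqr.
Qed.

Lemma cplx_ball_Im (z w : R[i]) (e : R) : `|z - w| < e%:C ->
  `|complex.Im z - complex.Im w| < e.
Proof.
move=> h; have := @cplx_ball_Re ('i%C * w) ('i%C * z) e.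
rewrite -mulrBr normrM norm_i mul1r distrC => /(_ h).
by case: z w h => [a b] [c d] _ /=; rewrite !mul0r !mul1r !sub0r opprK addrC.
Qed.

Lemma cplx_complete (F : set_system (cplx R)) : ProperFilter F -> cauchy F -> cvg F.
Proof.
move=> FF /cauchyP hF.
have cRe : cvg ((fun z : cplx R => complex.Re (z : R[i])) @ F).
  apply: cauchy_cvg; apply/cauchyP => e e0.
  have [|x hx] := hF e%:C; first by rewrite ltcR.
  exists (complex.Re x).
  rewrite -[_ (ball _ _)]/(F ((fun z : cplx R => complex.Re (z : R[i])) @^-1`
    ball (complex.Re x) e)).
  apply: filterS hx => y; rewrite -!ball_normE /=.
  exact: cplx_ball_Re.
have cIm : cvg ((fun z : cplx R => complex.Im (z : R[i])) @ F).
  apply: cauchy_cvg; apply/cauchyP => e e0.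
  have [|x hx] := hF e%:C; first by rewrite ltcR.
  exists (complex.Im x).
  rewrite -[_ (ball _ _)]/(F ((fun z : cplx R => complex.Im (z : R[i])) @^-1`
    ball (complex.Im x) e)).
  apply: filterS hx => y; rewrite -!ball_normE /=.
  exact: cplx_ball_Im.
move/cvg_ex : cRe => [a /cvgrPdist_lt ha]; move/cvg_ex : cIm => [b /cvgrPdist_lt hb].
apply/cvg_ex; exists (Complex a b); apply/cvgrPdist_lt => eps0 eps00.
have [e e0 ->] := pos_complexP eps00.
have e2 : 0 < e / 2 by rewrite divr_gt0.
near=> x.
apply: le_lt_trans (norm_complex_le _) _; rewrite ltcR [ltRHS]splitr.
have -> : complex.Re (Complex a b - x) = a - complex.Re x by case: (x).
have -> : complex.Im (Complex a b - x) = b - complex.Im x by case: (x).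
apply: ltrD; first by near: x; exact: ha.
by near: x; exact: hb.
Unshelve. all: by end_near. Qed.

HB.instance Definition _ := Uniform_isComplete.Build (cplx R) cplx_complete.


Let cinner (x y : cplx R) : R[i] := (x : R[i])^J * (y : R[i]).

Let cinner_linear (x : cplx R) (a : R[i]) (y z : cplx R) :
  cinner x (a *: y + z) = a * cinner x y + cinner x z.
Proof. by rewrite /cinner [a *: y + z]/(a * (y : R[i]) + (z : R[i])) mulrDr mulrCA. Qed.
Let cinner_conj (x y : cplx R) : cinner y x = (cinner x y)^J.
Proof. by rewrite /cinner conjcM conjcK mulrC. Qed.
Let cinner_norm (x : cplx R) : cinner x x = `|x| ^+ 2.
Proof. exact: mulcJr. Qed.

HB.instance Definition _ :=
  isHilbert.Build R (cplx R) cinner_linear cinner_conj cinner_norm.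

Lemma inner_cplx (x y : cplx R) : inner x y = (x : R[i])^J * (y : R[i]).
Proof. by []. Qed.

End Cplx.


(** * Weak-star continuity of products and bounded nets *)

Lemma cvg_eq (X : Type) (V : topologicalType) (f : X -> V) (F : set_system X)
  (l l' : V) : f @ F --> l -> l = l' -> f @ F --> l'.
Proof. by move=> + <-. Qed.

Section Summable.
Context {R : realType}.

Lemma summable_le (u v : nat -> R[i]^o) (c : R) :
  (forall n, 0 <= v n <= c%:C * u n) -> 0 <= c -> (forall n, 0 <= u n) ->
  cvgn (series u) -> cvgn (series v).
Proof.
move=> hv c0 u0 /cvg_cauchy /cauchy_seriesP hu.
have : cauchy (series (v : nat -> cplx R) @ \oo).
  apply/cauchy_seriesP => e e0.
  have c1 : 0 < c%:C + 1 :> R[i] by rewrite ltr_wpDl// ler0c.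
  have /hu : 0 < e / (c%:C + 1) by rewrite divr_gt0.
  apply: filterS => n; rewrite ltr_pdivlMr//; apply: le_lt_trans.
  rewrite !ger0_norm ?sumr_ge0//; last by move=> i _; case/andP: (hv i).
  rewrite mulr_suml; apply: ler_sum => i _; case/andP: (hv i) => _ /le_trans; apply.
  by rewrite mulrC ler_wpM2l// lerDl.
by move=> /cauchy_cvg.
Qed.

Lemma square_summable_bop (H K : hilbertType R) (x : bop H K) (xi : nat -> H) :
  square_summable xi -> square_summable (x \o xi).
Proof.
have [c c0 hc] := bop_bound x.
apply: (@summable_le _ _ (c ^+ 2)) => [n||n]; last 2 first.
- by rewrite exprn_ge0.
- by rewrite exprn_ge0.
rewrite exprn_ge0//= CrX -exprMn ler_pXn2r ?nnegrE ?mulr_ge0 ?ler0c//.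
Qed.

(** Precomposing a normal functional given by (xi, eta) with T |-> c T d gives the
    normal functional of (d xi, c^* eta). *)
Lemma normal_map_comp (H K H' K' : hilbertType R) (c : bop K K') (d : bop H' H) :
  normal_map (fun T : bop H K => c \ob T \ob d).
Proof.
split=> [a x y|w [xi [eta [hxi heta hw]]]].
  by rewrite bcompDr bcompZr bcompDl bcompZl.
move=> T; apply: normal_continuous.
exists (d \o xi), (adj c \o eta); split; [exact: square_summable_bop|
  exact: square_summable_bop|] => S.
rewrite (_ : (fun n => _) = fun n => inner (eta n) ((c \ob S \ob d) (xi n)) : R[i]^o).
  exact: hw.
by apply/funext => n /=; rewrite adjl.
Qed.

Lemma normal_map_compl (H K K' : hilbertType R) (c : bop K K') :
  normal_map (fun T : bop H K => c \ob T).
Proof.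
rewrite (_ : (fun T => _) = (fun T => c \ob T \ob bid H)).
  exact: normal_map_comp.
by apply/funext => T; rewrite bcomp1r.
Qed.

Lemma normal_map_compr (H K H' : hilbertType R) (d : bop H' H) :
  normal_map (fun T : bop H K => T \ob d).
Proof.
rewrite (_ : (fun T => _) = (fun T => bid K \ob T \ob d)).
  exact: normal_map_comp.
by apply/funext => T; rewrite bcomp1l.
Qed.

Lemma bop_continuous (H K : hilbertType R) (x : bop H K) : continuous x.
Proof.
move=> h; apply/cvgrPdist_lt => e e0.
have [c c0 hc] := bop_bound x.
have c1 : 0 < c%:C + 1 :> R[i] by rewrite ltr_wpDl// ler0c.
have /(cvgrPdist_lt _ _).1 := @cvg_id _ (nbhs h).
move=> /(_ (e / (c%:C + 1))); rewrite divr_gt0// => /(_ isT).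
apply: filterS => k; rewrite ltr_pdivlMr//; apply: le_lt_trans.
rewrite -linearB mulrC; apply: le_trans (hc _) _.
by rewrite ler_wpM2r// lerDl.
Qed.

(** A normal functional is a series whose tails are bounded by the tails of
    sum (|eta n|^2 + |xi n|^2) uniformly over a norm-bounded net, and on each
    partial sum strong convergence is enough. *)
Lemma bounded_strong_weak (H K : hilbertType R) (X : Type) (F : set_system X)
    (FF : ProperFilter F) (f : X -> bop H K) (T : bop H K) (c : R) : 0 <= c ->
  (forall x h, `|f x h| <= c%:C * `|h|) -> (forall h, `|T h| <= c%:C * `|h|) ->
  (forall h, f x h @[x --> F] --> T h) -> f @ F --> T.
Proof.
move=> c0 hf hT hs; apply: weak_cvg => w hw.
have wB S S' : w (S - S') = w S - w S'.
  by rewrite addrC -scaleN1r normal_linear// mulN1r addrC.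
have [xi [eta [hxi heta hlim]]] := hw.
apply/cvgrPdist_le => e e0.
have e2 : 0 < e / 2 by rewrite divr_gt0.
pose u n : R[i]^o := `|eta n| ^+ 2 + `|xi n| ^+ 2.
have cu : cvgn (series u).
  have := is_cvg_seriesD heta hxi; set g := (X in series X).
  by rewrite (_ : g = u)//; apply/funext.
have c1 : 0 < c%:C + 1 :> R[i] by rewrite ltr_wpDl// ler0c.
have [N hN] : exists N, forall m, (N <= m)%N ->
    \sum_(N <= n < m) u n <= e / 2 / (c%:C + 1).
  have /cvg_cauchy /cauchy_seriesP := cu.
  move=> /(_ (e / 2 / (c%:C + 1))); rewrite divr_gt0// => /(_ isT).
  move=> [[A B] /= [[a _ ha] [b _ hb]] hAB].
  exists (maxn a b) => m hm.
  have := hAB (maxn a b, m); rewrite /= => /(_ _)/ltW h.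
  apply: le_trans (h _); last first.
    split; [apply: ha => /=; exact: leq_maxl|apply: hb => /=].
    exact: leq_trans (leq_maxr _ _) hm.
  by rewrite real_ler_norm// ger0_real// sumr_ge0// => i _; rewrite addr_ge0 ?exprn_ge0.
have tail x : `|w (T - f x) -
    \sum_(0 <= n < N) inner (eta n) ((T - f x) (xi n))| <= e / 2.
  have := hlim (T - f x) => /cvgrPdist_lt hl.
  apply/ler_addgt0Pr => d d0.
  have [M _ hM] := hl d d0.
  have := hM (maxn N M) (leq_maxr _ _); rewrite /series /= => h.
  apply: le_trans (ler_distD
    (\sum_(0 <= k < maxn N M) inner (eta k) ((T - f x) (xi k))) _ _) _.
  rewrite [leRHS]addrC; apply: lerD; first exact: ltW.
  rewrite (@big_cat_nat _ _ _ N)//= ?leq_maxl// [X in `|X|]addrAC subrr add0r.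
  apply: le_trans (ler_norm_sum _ _ _) _.
  apply: (@le_trans _ _ (\sum_(N <= n < maxn N M) (c%:C + 1) * u n)).
    apply: ler_sum => n _; apply: le_trans (inner_le _ _) _.
    apply: (@le_trans _ _ (`|eta n| * (2 * c%:C * `|xi n|))).
      rewrite ler_wpM2l//.
      apply: (le_trans (ler_normB (T (xi n)) (f x (xi n)))).
      by rewrite -mulrA mulr_natl mulr2n; apply: lerD.
    apply: (@le_trans _ _ (c%:C * u n)).
      rewrite -subr_ge0 (_ : _ - _ = c%:C * (`|eta n| - `|xi n|) ^+ 2).
        by rewrite mulr_ge0 ?ler0c// -realEsqr rpredB// ger0_real.
      rewrite /u; ring.
    by rewrite ler_wpM2r ?lerDl// addr_ge0 ?exprn_ge0.
  rewrite -mulr_sumr mulrC -ler_pdivlMr//; apply: hN.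
  exact: leq_maxl.
have : (\sum_(0 <= n < N) inner (eta n) ((T - f x) (xi n)) : R[i]^o)
    @[x --> F] --> (0 : R[i]^o).
  elim: N {hN tail} => [|N IH].
    rewrite (_ : (fun _ => _) = cst 0); first exact: cvg_cst.
    by apply/funext => x; rewrite big_nil.
  rewrite (_ : (fun _ => _) =
     (fun x => \sum_(0 <= n < N) inner (eta n) ((T - f x) (xi n)) : R[i]^o)
     + (fun x => inner (eta N) ((T - f x) (xi N)) : R[i]^o)); last first.
    by apply/funext => x; rewrite big_nat_recr.
  suff h2 : (inner (eta N) ((T - f x) (xi N)) : R[i]^o) @[x --> F] --> (0 : R[i]^o).
    exact: (cvg_eq (cvgD IH h2) (addr0 _)).
  apply/cvgrPdist_lt => d d0.
  have n1 : 0 < `|eta N| + 1 by rewrite ltr_wpDl.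
  have /cvgrPdist_lt/(_ (d / (`|eta N| + 1))) := hs (xi N).
  rewrite divr_gt0// => /(_ isT); apply: filterS => x.
  rewrite ltr_pdivlMr// sub0r normrN; apply: le_lt_trans.
  apply: le_trans (inner_le _ _) _; rewrite mulrC.
  apply: (@le_trans _ _ (`|T (xi N) - f x (xi N)| * `|eta N|)) => //.
  by rewrite ler_wpM2l// lerDl.
move=> /cvgrPdist_lt /(_ _ e2); apply: filterS => x; rewrite sub0r normrN => hx.
rewrite -wB -[w _](subrK (\sum_(0 <= n < N) inner (eta n) ((T - f x) (xi n)))).
apply: le_trans (ler_normD _ _) _; rewrite [leRHS]splitr; apply: lerD; first exact: tail.
exact: ltW.
Qed.

End Summable.


(** * Slices of a Hilbert tensor product *)

(** Finite lists directed by inclusion, to index the finite-rank projections of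
    a possibly non-separable space. *)
Definition list_filter (X : eqType) : set_system (seq X) :=
  filter_from setT (fun s0 : seq X => [set s : seq X | {subset s0 <= s}]).

Arguments list_filter : clear implicits.

#[local] Instance list_filter_proper (X : eqType) : ProperFilter (list_filter X).
Proof.
apply: filter_from_proper; last by move=> s _; exists s.
apply: filter_from_filter; first by exists [::].
move=> s1 s2 _ _; exists (s1 ++ s2) => // s hs.
by split=> x hx; apply: hs; rewrite mem_cat hx ?orbT.
Qed.

Section Tensor.
Context {R : realType} {K L T : hilbertType R} {tau : K -> L -> T}.
Hypothesis ht : hilbert_tensor tau.

Lemma tensorDr k l m : tau k (l + m) = tau k l + tau k m.
Proof. by have := tensor_linearr ht k 1 l m; rewrite !scale1r. Qed.
Lemma tensor0r k : tau k 0 = 0.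
Proof. by have := tensor_linearr ht k (-1) 0 0; rewrite scaler0 addr0 scaleN1r addNr. Qed.
Lemma tensorZr k a l : tau k (a *: l) = a *: tau k l.
Proof. by have := tensor_linearr ht k a l 0; rewrite tensor0r !addr0. Qed.
Lemma tensor_sumr k (I : Type) (r : seq I) (P : pred I) (F : I -> L) :
  tau k (\sum_(i <- r | P i) F i) = \sum_(i <- r | P i) tau k (F i).
Proof. exact: (big_morph (tau k) (tensorDr k) (tensor0r k)). Qed.
Lemma tensor0l l : tau 0 l = 0.
Proof. by have := tensor_linearl ht l (-1) 0 0; rewrite scaler0 addr0 scaleN1r addNr. Qed.
Lemma tensorZl a k l : tau (a *: k) l = a *: tau k l.
Proof. by have := tensor_linearl ht l a k 0; rewrite tensor0l !addr0. Qed.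

Lemma tensor_norm k l : `|tau k l| = `|k| * `|l|.
Proof.
apply/eqP; rewrite -(@eqrXn2 _ 2)// ?mulr_ge0//.
by rewrite -inner_norm exprMn (tensor_inner ht) !inner_norm.
Qed.

(** The map k |-> k (x) l, whose adjoint is the slice at l. *)
Lemma coslice_exists l : exists J : bop K T, forall k, J k = tau k l.
Proof.
apply: bop_exists => [a x y|]; first exact: (tensor_linearl ht).
exists (complex.Re `|l|) => k.
by rewrite tensor_norm mulrC RRe_real// ger0_real.
Qed.

Lemma adj_coslice l (J : bop K T) : (forall k, J k = tau k l) ->
  is_slice tau l (adj J).
Proof.
move=> hJ k m; apply: inner_inj => z.
by rewrite adjr hJ (tensor_inner ht) innerZr mulrC.
Qed.

Lemma tensor_ext (G : hilbertType R) (P Q : bop T G) :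
  (forall k l, P (tau k l) = Q (tau k l)) -> P = Q.
Proof.
move=> h; apply: bopP => t.
have : closed_span [set tau k l | k in setT & l in setT] t.
  by rewrite (tensor_total ht).
apply: (@closed_span_sub _ _ _ [set t | P t = Q t]); last first.
  by move=> _ [k _ [l _ <-]]; exact: h.
split; first split=> [|a x y].
    by rewrite /= !linear0.
  by rewrite /= !bop_linear => -> ->.
rewrite (_ : [set t | _] = (P - Q) @^-1` [set 0]).
  apply: preimage_closed => [x _|]; first exact: bop_continuous.
  exact: (accessible_closed_set1 (hausdorff_accessible (@norm_hausdorff _ _))).
apply/seteqP; split=> x; rewrite /preimage /= => hx.
  by rewrite -[LHS]/(P x - Q x) hx subrr.
by apply/eqP; rewrite -subr_eq0; apply/eqP.
Qed.

Lemma slice_adj l (P : bop T K) k : is_slice tau l P -> adj P k = tau k l.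
Proof.
move=> hP; have [J hJ] := coslice_exists l.
have -> : P = adj J by apply: tensor_ext => x y; rewrite hP (adj_coslice hJ).
by rewrite adjK hJ.
Qed.

Lemma ampliation_id (Y : bop T T) : is_ampliation tau (bid K) Y -> Y = bid T.
Proof. by move=> h; apply: tensor_ext => k l; rewrite h. Qed.

(* The compression 1 (x) p, where p is the orthogonal projection of L onto the
   span of s. Contractivity comes from 1 (x) p being a self-adjoint idempotent. *)
Let projs (s : seq L) : exists p : bop T T,
  [/\ (forall V, closed_subspace V ->
        (forall a (P : bop T K), is_slice tau a P -> V (adj P \ob P)) -> V p),
      (forall k l, l \in s -> p (tau k l) = tau k l) &
      (forall t, `|p t| <= `|t|)].
Proof.
have [e [eW eP]] := parseval_frame (inner_semi L) (size s) (nth 0 s).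
have [J hJ] := choice coslice_exists.
pose p := \sum_(j < size s) J (e j) \ob adj (J (e j)).
have [W WP] : exists W : set L, forall l, W l <-> forall k, p (tau k l) = tau k l.
  by eexists => l; split; exact.
have sW : submod W.
  split=> [|a x y /WP hx /WP hy]; apply/WP => k; first by rewrite tensor0r linear0.
  by rewrite (tensor_linearr ht) bop_linear hx hy.
have sin i : (i < size s)%N -> W (nth 0 s i).
  move=> hi; apply/WP => k; set l := nth 0 s i.
  have lE : l = \sum_(j < size s) inner (e j) l *: e j.
    apply: inner_inj => z; rewrite inner_conj (eP i hi) inner_sumr conjc_sum.
    by apply: eq_bigr => j _; rewrite conjcM -!inner_conj innerZr mulrC.
  rewrite /p bop_sumE [in RHS]lE tensor_sumr; apply: eq_bigr => j _ /=.
  by rewrite hJ (adj_coslice (hJ (e j))) tensorZr tensorZl.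
have eW' j : (j < size s)%N -> W (e j) by apply: eW.
have pp : p \ob p = p.
  rewrite {2}/p bcomp_sumr; apply: eq_bigr => j _; rewrite bcompA; congr (_ \ob _).
  by apply: bopP => k /=; rewrite hJ; have /WP := eW' j (ltn_ord j); exact.
have padj : adj p = p.
  by rewrite /p adj_sum; apply: eq_bigr => j _; rewrite adj_comp adjK.
exists p; split=> [V [sV _] hV|k l ls|t].
- apply: submod_sum => // j _.
  by have := hV (e j) _ (adj_coslice (hJ (e j))); rewrite adjK.
- by have := sin (index l s); rewrite index_mem nth_index// => /(_ ls)/WP.
- apply: norm_inner_le => //.
  have -> : inner (p t) (p t) = inner t (p t).
    by rewrite -{1}padj adjl -[p (p t)]/((p \ob p) t) pp.
  apply: le_trans (inner_le _ _); rewrite real_ler_norm// ger0_real//.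
  by rewrite -pp /= -{1}padj adjr inner_ge0.
Qed.

(** A closed subspace containing the operators 1 (x) |a><a| contains the
    projections 1 (x) p with p of finite rank; these are contractive and converge
    strongly to 1, since they eventually fix each elementary tensor. *)
Lemma slices_total (D : set (bop T T)) : closed_subspace D ->
  (forall a (P : bop T K), is_slice tau a P -> D (adj P \ob P)) -> D (bid T).
Proof.
move=> cD hD; have [p hp] := choice projs.
have pconv : p @ (list_filter L) --> bid T.
  apply: (@bounded_strong_weak _ _ _ _ _ (list_filter_proper L) _ _ 1) => //.
  - by move=> s t; rewrite mul1r; have [_ _] := hp s; exact.
  - by move=> t; rewrite mul1r.
  move=> t /=.
  have : closed_span [set tau k l | k in setT & l in setT] t.
    by rewrite (tensor_total ht).
  apply: (@closed_span_sub _ _ _ [set t | p s t @[s --> (list_filter L)] --> t]); last first.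
    move=> _ [k _ [l _ <-]] /=; apply: cvg_near_cst.
    exists [:: l] => // s hs; have [_ h _] := hp s; apply: h.
    have {}hs : {subset [:: l] <= s} := hs.
    by apply: hs; rewrite mem_head.
  split.
    split=> [|a x y /= hx hy].
      rewrite /= (_ : (fun _ => _) = cst 0); first exact: cvg_cst.
      by apply/funext => s; rewrite linear0.
    rewrite (_ : (fun _ => _) = (fun s => a *: p s x + p s y)).
      by apply: cvgD => //; apply: cvgZr.
    by apply/funext => s; rewrite bop_linear.
  move=> x hx; apply/cvgrPdist_lt => e e0.
  have e3 : 0 < e / 3 by rewrite divr_gt0.
  have [y [/= /cvgrPdist_lt/(_ _ e3) hy]] := hx _ (nbhsx_ballx x _ e3).
  rewrite -ball_normE /= => xy; apply: filterS hy => s hs.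
  rewrite (_ : x - p s x = (x - y) + ((y - p s y) + p s (y - x))); last first.
    by rewrite linearB !subrKA.
  apply: le_lt_trans (ler_normD _ _) _.
  rewrite (_ : e = e / 3 + (e / 3 + e / 3)); last by field.
  apply: ltrD => //; apply: le_lt_trans (ler_normD _ _) _.
  apply: ltrD => //; have [_ _ h] := hp s; apply: le_lt_trans (h _) _.
  by rewrite distrC.
have [_ clD] := cD; refine (@closed_cvg _ _ _ (list_filter_proper L) p D clD _ _ pconv).
by exists [::] => // s _; have [h _ _] := hp s; exact: h.
Qed.

End Tensor.


(** * Rank-one operators *)

Section RankOne.
Context {R : realType}.

Lemma rank1_exists (H K : hilbertType R) (a : K) (b : H) :
  exists x : bop H K, forall h, x h = inner b h *: a.
Proof.
apply: bop_exists => [c x y|]; first by rewrite innerDr innerZr scalerDl scalerA.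
exists (complex.Re `|b| * complex.Re `|a|) => h.
rewrite normrZ CrM !RRe_real ?ger0_real// mulrAC.
by rewrite ler_wpM2r// inner_le.
Qed.

(** The operator |a><b|. *)
Definition rank1 (H K : hilbertType R) (a : K) (b : H) : bop H K :=
  projT1 (cid (rank1_exists a b)).

Lemma rank1E (H K : hilbertType R) (a : K) (b h : H) :
  rank1 a b h = inner b h *: a.
Proof. by rewrite /rank1; case: cid. Qed.

(** This is [slices_total] for the tensor product of H with the scalars. *)
Lemma rank1_total (H : hilbertType R) (D : set (bop H H)) : closed_subspace D ->
  (forall a, D (rank1 a a)) -> D (bid H).
Proof.
move=> cD hD.
pose tau (c : cplx R) (h : H) : H := (c : R[i]) *: h.
have ht : hilbert_tensor tau.
  split=> [l a x y|k a x y|k k' l l'|].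
  - by rewrite /tau scalerA -scalerDl.
  - by rewrite /tau scalerDr !scalerA mulrC.
  - by rewrite /tau innerZl innerZr inner_cplx mulrA.
  - apply/seteqP; split=> // h _; apply: sub_closed_span.
    by exists (1 : R[i]) => //; exists h => //; rewrite /tau scale1r.
apply: (slices_total ht) => // a P hP.
rewrite (_ : _ \ob P = rank1 a a)//; apply: bopP => h /=.
rewrite rank1E (slice_adj ht _ hP) -[in LHS](scale1r h).
rewrite -[1 *: h]/(tau (1 : R[i]) h) hP /tau.
by congr (_ *: _); exact: mulr1.
Qed.

Lemma adj_rank1 (H K : hilbertType R) (a : K) (b : H) :
  adj (rank1 a b) = rank1 b a.
Proof.
apply/esym/adj_uniq => x y; rewrite !rank1E innerZr innerZl -inner_conj.
by rewrite mulrC.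
Qed.

Lemma comp_rank1l (H K L : hilbertType R) (x : bop K L) (a : K) (b : H) :
  x \ob rank1 a b = rank1 (x a) b.
Proof. by apply: bopP => h /=; rewrite !rank1E linearZ. Qed.

Lemma comp_rank1r (H K L : hilbertType R) (x : bop H K) (a : L) (b : K) :
  rank1 a b \ob x = rank1 a (adj x b).
Proof. by apply: bopP => h /=; rewrite !rank1E adjl. Qed.

End RankOne.

(** * The image of the unit dominates *)

Section Forward.
Context {R : realType}.

Definition bpow (H : hilbertType R) (x : bop H H) (k : nat) : bop H H :=
  iter k (bcomp x) (bid H).

Lemma bpowSr (H : hilbertType R) (x : bop H H) k : bpow x k.+1 = bpow x k \ob x.
Proof.
elim: k => [|k IH]; first by rewrite /bpow /= bcomp1l bcomp1r.
by rewrite {1}/bpow iterS -/(bpow x k.+1) {1}IH bcompA.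
Qed.

(** Write the polynomial as c_0 + s x. If c_0 is invertible, then - s / c_0 is the
    required z. Otherwise the polynomial is x s, and x x s = 0 implies x s = 0
    because x is self-adjoint, so the degree can be lowered. The extra factor x
    in the hypothesis makes this induction start. *)
Lemma regular_of_poly (H : hilbertType R) (x : bop H H) (m : nat) (c : nat -> R[i]) :
  self_adjoint x -> x \ob (\sum_(i < m) c i *: bpow x i) = 0 ->
  (exists2 i, (i < m)%N & c i != 0) -> exists z : bop H H, x \ob z \ob x = x.
Proof.
move=> xsa; elim: m c => [|m IH] c hc [i im ci]; first by [].
pose s := \sum_(i < m) c i.+1 *: bpow x i.
have sE : \sum_(i < m.+1) c i *: bpow x i = c 0 *: bid H + s \ob x.
  rewrite big_ord_recl /=; congr (_ + _); rewrite bcomp_suml.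
  by apply: eq_bigr => j _; rewrite bcompZl -bpowSr.
have [c0|c0] := eqVneq (c 0%N) 0.
  apply: (IH (fun i => c i.+1)).
    have sE' : s \ob x = x \ob s.
      rewrite bcomp_suml bcomp_sumr; apply: eq_bigr => j _.
      by rewrite bcompZl bcompZr -bpowSr.
    move: hc; rewrite sE c0 scale0r add0r sE' => hc.
    apply: bopP => h; apply: inner_eq0.
    by rewrite /= xsa -[x (x _)]/((x \ob (x \ob s)) h) hc inner0l.
  case: i im ci => [|i] im ci; first by rewrite c0 eqxx in ci.
  by exists i.
exists (- (c 0)^-1 *: s); move: hc; rewrite sE bcompDr bcompZr bcomp1r => /eqP.
rewrite addrC addr_eq0 => /eqP hc.
by rewrite bcompZr bcompZl -bcompA hc scalerN scaleNr opprK scalerA mulVf ?scale1r.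
Qed.

(** More powers of x than the dimension of M are linearly dependent. *)
Lemma finite_dim_regular (H : hilbertType R) (M : set (bop H H)) (x : bop H H) :
  von_neumann M -> finite_dim M -> M x -> self_adjoint x ->
  exists z : bop H H, x \ob z \ob x = x.
Proof.
move=> [_ M1 MM _] [n [b Mb]] Mx xsa.
have Mp k : M (bpow x k) by elim: k => [//|k IH]; exact: MM.
have hc k : exists c : 'I_n -> R[i], bpow x k = \sum_i c i *: b i.
  by have := Mp k; rewrite Mb => -[c _ <-]; exists c.
have [C hC] := choice hc.
pose A : 'M[R[i]]_(n.+1, n) := \matrix_(i, j) C i j.
have : kermx A != 0.
  rewrite kermx_eq0 /row_free; apply/eqP => rA.
  by have := rank_leq_col A; rewrite rA ltnn.
move=> /rowV0Pn[u /sub_kermxP uA u0].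
apply: (@regular_of_poly _ _ n.+1 (fun i => u 0 (inord i))) => //.
  rewrite (_ : \sum_(i < _) _ = 0) ?bcomp0r//.
  under eq_bigr => i _ do rewrite inord_val hC scaler_sumr.
  rewrite exchange_big big1 //= => j _.
  under eq_bigr => i _ do rewrite scalerA.
  move/matrixP/(_ 0 j) : uA; rewrite !mxE => h.
  rewrite -scaler_suml [X in X *: _](_ : _ = 0) ?scale0r//.
  apply: etrans h.
  by apply: eq_bigr => i _; rewrite mxE.
apply: contrapT => h; case/eqP: u0; apply/rowP => i; rewrite mxE.
apply/eqP; apply: contrapT => /negP ui; apply: h; exists i => //.
by rewrite inord_val.
Qed.

Lemma self_adjointP (H : hilbertType R) (x : bop H H) :
  self_adjoint x <-> adj x = x.
Proof.
split=> [h|h]; first by rewrite -(adj_uniq h).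
by move=> a b; rewrite -{2}h adjl.
Qed.

Lemma real_normP (z : R[i]) : z^J = z -> - `|z| <= z <= `|z|.
Proof.
move=> zJ; have zr : z \is Num.real by apply/CrealP.
apply/andP; split; last exact: real_ler_norm.
by rewrite lerNl -normrN real_ler_norm// rpredN.
Qed.

(** Here x0 = v^* v belongs to S by slicing, and every element
    of S is fixed by right multiplication by p = z x0. *)
Lemma arises_dominating (H : hilbertType R) (M S : set (bop H H))
    (hM : von_neumann M) (hMfin : finite_dim M) (K : hilbertType R)
    (N : set (bop K K)) (theta : bop K K -> bop H H) :
  arises_from M S N theta -> dominating M S (theta (bid K)).
Proof.
move=> [[_ N1 _ _] [thM _ _ _] [V [L [T [tau [v [ht [w /adj_uniq wv hst] Vdef]]]]] Sdef]].
have [Y /(ampliation_id ht) YE x0E] := hst _ N1; rewrite {}YE bcomp1r {}wv in x0E.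
set x0 := theta (bid K) in x0E *.
have Mx0 : M x0 by exact: thM.
have x0sa : self_adjoint x0.
  by apply/self_adjointP; rewrite x0E adj_comp adjK.
have Vgen y' a (P : bop T K) : commutant N y' -> is_slice tau a P ->
    V (y' \ob P \ob v).
  by move=> hy hP; rewrite Vdef; apply: sub_closed_span; exists y', a, P.
have x0norm h : inner h (x0 h) = `|v h| ^+ 2.
  by rewrite x0E /= adjr inner_norm.
have Sx0 : S x0.
  rewrite x0E -[adj v]bcomp1r.
  have clS : closed_subspace S by rewrite Sdef; exact: closed_span_closed.
  have := normal_map_preimage (normal_map_comp (adj v) v) clS.
  move=> /(slices_total ht); apply=> a P hP; rewrite /preimage /= Sdef.
  apply: sub_closed_span; exists (adj (P \ob v)); first exists (P \ob v).
  - rewrite -[P]bcomp1l; apply: Vgen hP => x _; by rewrite bcomp1l bcomp1r.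
  - exact: adjP.
  exists (P \ob v); last by rewrite adj_comp !bcompA.
  rewrite -[P]bcomp1l; apply: Vgen hP => x _; by rewrite bcomp1l bcomp1r.
split=> //.
  by move=> h; rewrite subr0 x0norm exprn_ge0.
have [z zx] := finite_dim_regular hM hMfin Mx0 x0sa.
pose p := z \ob x0.
have x0p h : x0 (p h) = x0 h by rewrite -[in RHS]zx.
have vp : v \ob p = v.
  apply: bopP => h; apply/eqP; rewrite -subr_eq0.
  rewrite (_ : _ - _ = v (p h - h)); last by rewrite linearB.
  rewrite -normr_eq0 -sqrf_eq0 -x0norm.
  rewrite (_ : x0 _ = 0) ?inner0r//; apply: etrans (linearB x0 (p h) h) _.
  by apply/eqP; rewrite subr_eq0; apply/eqP; exact: x0p.
(* Being annihilated by q on the right is a weak-star closed condition. *)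
pose q := p - bid H.
have vq : v \ob q = 0 by rewrite bcompDr bcompNr vp bcomp1r subrr.
have hV y : V y -> y \ob q = 0.
  move: y; rewrite Vdef.
  apply: (closed_span_sub (normal_map_ker (normal_map_compr K q))).
  by move=> _ [y' [a [P [_ _ ->]]]] /=; rewrite -bcompA vq bcomp0r.
have hS y : S y -> y \ob q = 0.
  move: y; rewrite Sdef.
  apply: (closed_span_sub (normal_map_ker (normal_map_compr H q))).
  by move=> _ [a _ [b Vb <-]] /=; rewrite -bcompA hV// bcomp0r.
have Sp x : S x -> x \ob p = x.
  move=> /hS; rewrite bcompDr bcompNr bcomp1r => /eqP.
  by rewrite subr_eq0 => /eqP.
move=> x Sx xsa.
have [c c0 hc] := bop_bound x; have [cz cz0 hcz] := bop_bound z.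
have [cw cw0 hcw] := bop_bound (adj v).
pose t0 := c * (cz * cw) ^+ 2.
have t00 : 0 <= t0 by rewrite mulr_ge0// exprn_ge0// mulr_ge0.
have key h : `|inner h (x h)| <= (t0 + 1)%:C * inner h (x0 h).
  (* both p h = z (v^* (v h)) and its image under x are controlled by |v h| *)
  have -> : inner h (x h) = inner (p h) (x (p h)).
    have xp : x (p h) = x h by rewrite -[in RHS](Sp x Sx).
    by rewrite xp [LHS]xsa [RHS]xsa xp.
  have ph : `|p h| <= (cz * cw)%:C * `|v h|.
    apply: le_trans (hcz _) _; rewrite CrM -mulrA ler_wpM2l ?ler0c//.
    by rewrite x0E; exact: hcw.
  apply: le_trans (inner_le _ _) _; apply: le_trans (ler_wpM2l _ (hc _)) _ => //.
  rewrite x0norm mulrCA -expr2.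
  apply: (@le_trans _ _ (c%:C * ((cz * cw)%:C * `|v h|) ^+ 2)).
    rewrite ler_wpM2l ?ler0c// ler_pXn2r ?nnegrE ?mulr_ge0 ?ler0c ?mulr_ge0//.
  rewrite exprMn mulrA ler_wpM2r ?exprn_ge0// -CrX -CrM lecR lerDl//.
have hreal h : (inner h (x h))^J = inner h (x h) by rewrite -inner_conj -xsa.
exists (t0 + 1); first by rewrite ltr_wpDl.
split=> h; rewrite ?opprK; have /andP[h1 h2] := real_normP (hreal h).
- rewrite bopDE bopZE innerDr innerZr -lerBlDl sub0r.
  by apply: le_trans (key h); rewrite lerNl.
- rewrite bopBE bopZE innerBr innerZr subr_ge0.
  exact: le_trans (key h).
Qed.

End Forward.


(** * Finite orthogonal sums *)

(** An alias, so that the norm attached to it is the l2 norm. *)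
Definition l2sum (R : realType) (I : finType) (H : hilbertType R) : Type :=
  {ffun I -> H}.

Section L2Sum.
Context {R : realType} {I : finType} {H : hilbertType R}.
Local Notation E := (l2sum I H).

HB.instance Definition _ := GRing.Lmodule.on E.
HB.instance Definition _ := GRing.Lmodule.copy E {ffun I -> H}.

Let ip (x y : E) : R[i] := \sum_i inner (x i) (y i).

Let ip_semi : semi_inner ip.
Proof.
split=> [x a y z|x y|x].
- rewrite /ip mulr_sumr -big_split; apply: eq_bigr => i _ /=.
  by rewrite !ffunE innerDr innerZr.
- by rewrite /ip conjc_sum; apply: eq_bigr => i _; exact: inner_conj.
- by rewrite /ip sumr_ge0// => i _; exact: inner_ge0.
Qed.

Let nm (x : E) : R[i] := sqrtc (ip x x).

Let nm_ge0 x : 0 <= nm x. Proof. by rewrite sqrtc_ge0; exact: (semi_ge0 ip_semi). Qed.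
Let nmX x : nm x ^+ 2 = ip x x. Proof. exact: sqr_sqrtc. Qed.

Let ip_le x y : `|ip x y| <= nm x * nm y.
Proof.
rewrite -(@ler_pXn2r _ 2)// ?nnegrE ?mulr_ge0//.
by rewrite exprMn !nmX; exact: (semi_CS ip_semi).
Qed.

Let nmD x y : nm (x + y) <= nm x + nm y.
Proof.
rewrite -(@ler_pXn2r _ 2)// ?nnegrE ?addr_ge0//.
rewrite sqrrD !nmX (semiDl ip_semi) !(semiDr ip_semi) -!addrA lerD2l.
rewrite !addrA lerD2r (semi_conj ip_semi x y) addcJ.
rewrite [leRHS](_ : _ = 2 * (nm x * nm y)) ?ler_wpM2l//; last by rewrite mulr_natl mulr2n.
apply: le_trans (ip_le x y); apply: le_trans (normc_ge_Re _).
by rewrite lecR ler_norm.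
Qed.

Let nmZ (a : R[i]) x : nm (a *: x) = `|a| * nm x.
Proof.
apply/eqP; rewrite -(@eqrXn2 _ 2)// ?mulr_ge0//.
rewrite exprMn !nmX (semiZl ip_semi) (semiZr ip_semi) mulrA mulcJr//.
Qed.

Let nm_eq0 x : nm x = 0 -> x = 0.
Proof.
move=> h; have : ip x x = 0 by rewrite -nmX h expr0n.
move=> /eqP; rewrite psumr_eq0 => [/allP hx|i _]; last exact: inner_ge0.
apply/ffunP => i; rewrite !ffunE; apply: inner_eq0; apply/eqP.
by have := hx i; rewrite mem_index_enum; exact.
Qed.

HB.instance Definition _ := Lmodule_isNormed.Build R[i] E nmD nmZ nm_eq0.

Let normE (x : E) : `|x| = nm x. Proof. by []. Qed.

Let coord_le (x : E) i : `|x i| <= `|x|.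
Proof.
rewrite -(@ler_pXn2r _ 2)// ?nnegrE// normE nmX -inner_norm /ip (bigD1 i)//= lerDl.
by rewrite sumr_ge0// => j _; exact: inner_ge0.
Qed.

Let norm_le_sum (x : E) : `|x| <= \sum_i `|x i|.
Proof.
rewrite -(@ler_pXn2r _ 2)// ?nnegrE ?sumr_ge0// normE nmX /ip expr2 mulr_suml.
apply: ler_sum => i _; rewrite inner_norm expr2 ler_wpM2l// (bigD1 i)//= lerDl.
by rewrite sumr_ge0.
Qed.

Let l2_complete (F : set_system E) : ProperFilter F -> cauchy F -> cvg F.
Proof.
move=> FF /cauchyP hF.
have hc i : exists y : H, (fun x : E => x i) @ F --> y.
  apply/cvg_ex; apply: cauchy_cvg; apply/cauchyP => e e0.
  have [x hx] := hF e e0; exists (x i).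
  rewrite -[_ (ball _ _)]/(F ((fun x : E => x i) @^-1` ball (x i) e)).
  apply: filterS hx => y; rewrite -!ball_normE /=; apply: le_lt_trans.
  by have := coord_le (x - y) i; rewrite !ffunE.
have [y hy] := choice hc.
apply/cvg_ex; exists (finfun y : E); apply/cvgrPdist_lt => e e0.
pose d := e / (#|I|.+1)%:R.
have d0 : 0 < d by rewrite divr_gt0.
have : \forall x \near F, forall i : I, `|y i - (x : E) i| < d.
  by apply: filter_forall => i; move/cvgrPdist_lt: (hy i); apply.
apply: filterS => x hx; apply: le_lt_trans (norm_le_sum _) _.
apply: (@le_lt_trans _ _ (\sum_(i : I) d)).
  by apply: ler_sum => i _; rewrite !ffunE; apply: ltW.
rewrite sumr_const -mulr_natr /d mulrAC ltr_pdivrMr// ltr_pM2l// ltr_nat//.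
Qed.

HB.instance Definition _ := Uniform_isComplete.Build E l2_complete.

HB.instance Definition _ := isHilbert.Build R E
  (semi_linear ip_semi) (semi_conj ip_semi) (fun x => esym (nmX x)).

Lemma inner_l2 (x y : E) : inner x y = \sum_i inner (x i) (y i).
Proof. by []. Qed.

End L2Sum.

(** * Averaging over a finite-dimensional algebra *)

(** A matrix of maximal rank among those with rows in A spans A. *)
Lemma finite_spanning (F : fieldType) (n : nat) (A : set 'rV[F]_n) :
  exists (m : nat) (s : 'I_m -> 'rV[F]_n), (forall i, A (s i)) /\
    forall x, A x -> exists c : 'I_m -> F, x = \sum_i c i *: s i.
Proof.
pose P (r : nat) := `[< exists (m : nat) (s : 'M[F]_(m, n)),
  (forall i, A (row i s)) /\ \rank s = r >].
have P0 : exists r, P r.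
  by exists 0%N; apply/asboolP; exists 0%N, 0; split; [case|exact: mxrank0].
have Pn r : P r -> (r <= n)%N by move=> /asboolP[m [s [_ <-]]]; exact: rank_leq_col.
have [r /asboolP[m [s [sA sr]]] rmax] := ex_maxnP P0 Pn.
exists m, (fun i => row i s); split=> // x Ax.
suff /submxP[D ->] : (x <= s)%MS.
  by exists (fun i => D 0 i); rewrite mulmx_sum_row.
apply: contraT => xs.
have : P (\rank (col_mx s x)).
  apply/asboolP; exists (m + 1)%N, (col_mx s x); split=> // i.
  case: (split_ordP i) => j ->; first by rewrite rowKu.
  by rewrite rowKd (_ : row j x = x)//; apply/rowP => k; rewrite mxE ord1.
move=> /rmax; rewrite -sr => h.
have : (s < col_mx s x)%MS.
  by rewrite ltmxE col_mx_sub (negbTE xs) andbF andbT -addsmxE addsmxSl.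
by rewrite ltmxErank => /andP[_]; rewrite ltnNge h.
Qed.

Section Frames.
Context {R : realType} {V : lmodType R[i]}.

(** Parseval families for B on W. When B is definite on W they satisfy the
    reconstruction formula [frame_expand], and behave as orthonormal bases. *)
Definition frame_on (W : set V) (B : V -> V -> R[i]) (n : nat) (e : 'I_n -> V) :=
  (forall k, W (e k)) /\
  forall x, W x -> forall y, B x y = \sum_k B x (e k) * B (e k) y.

Lemma frame_exists (W : set V) (B : V -> V -> R[i]) (n : nat) (b : 'I_n -> V) :
  semi_inner B -> W = [set \sum_i c i *: b i | c in [set: 'I_n -> R[i]]] ->
  exists e : 'I_n -> V, frame_on W B e.
Proof.
move=> hB WE.
have sW : submod W.
  rewrite WE; split.
    by exists (fun=> 0) => //; rewrite big1// => i _; rewrite scale0r.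
  move=> a _ _ [c _ <-] [d _ <-]; exists (fun i => a * c i + d i) => //.
  rewrite scaler_sumr -big_split /=; apply: eq_bigr => i _.
  by rewrite scalerDl scalerA.
have Wb i : W (b i).
  rewrite WE; exists (fun j => (j == i)%:R) => //.
  rewrite (bigD1 i)//= eqxx scale1r big1 ?addr0// => j /negbTE ->.
  by rewrite scale0r.
pose b' (k : nat) := if insub k is Some i then b i else 0.
have b'E (i : 'I_n) : b' i = b i by rewrite /b' valK.
have [e [eW eP]] := parseval_frame hB n b'.
exists (fun k => e k); split=> [k|x].
  by apply: eW => // i hi; rewrite -[ i ]/(val (Ordinal hi)) b'E.
rewrite WE => -[c _ <-] y; rewrite (semi_suml hB) .
under eq_bigr => i _ do rewrite (semiZl hB) -b'E (eP i (ltn_ord i)) mulr_sumr.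
rewrite exchange_big /=; apply: eq_bigr => k _.
rewrite (semi_suml hB) mulr_suml; apply: eq_bigr => i _.
by rewrite (semiZl hB) b'E mulrA.
Qed.

Lemma frame_expand (W : set V) (B : V -> V -> R[i]) (n : nat) (e : 'I_n -> V) :
  semi_inner B -> submod W -> (forall x, W x -> B x x = 0 -> x = 0) ->
  frame_on W B e -> forall x, W x -> x = \sum_k B (e k) x *: e k.
Proof.
move=> hB sW nd [We eP] x Wx; apply/eqP; rewrite -subr_eq0; apply/eqP.
set y := \sum_k _.
have Wy : W y by apply: submod_sum => // k _; exact: submodZ.
apply: nd; first exact: submodB.
have key z : W z -> B z (x - y) = 0.
  move=> Wz; rewrite (semiBr hB) (eP z Wz x) (semi_sumr hB).
  apply/eqP; rewrite subr_eq0; apply/eqP/eq_bigr => k _.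
  by rewrite (semiZr hB) mulrC.
by apply: key; exact: submodB.
Qed.

End Frames.

Section Averaging.
Context {R : realType} {H : hilbertType R} (M : set (bop H H)).
Hypotheses (hM : von_neumann M) (hMfin : finite_dim M).

Let sM : submod M. Proof. by have [[]] := hM. Qed.
Let M1 : M (bid H). Proof. by have [] := hM. Qed.
Let MM x y : M x -> M y -> M (x \ob y). Proof. by have [_ _ h _] := hM; exact: h. Qed.
Let MJ x : M x -> M (adj x).
Proof. by have [_ _ _ h] := hM => Mx; apply: h Mx _; exact: adjP. Qed.

(** The vectors (<k, b_i h>)_i of coefficients of a basis b of M, for h and k in
    H, are spanned by finitely many of them ([finite_spanning]); the corresponding
    h suffice to test whether an element of M vanishes. *)
Lemma separating_vectors : exists (m : nat) (h : 'I_m -> H),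
  forall a, M a -> (forall j, a (h j) = 0) -> a = 0.
Proof.
have [n [b ME]] := hMfin.
pose l (p : H * H) : 'rV[R[i]]_n := \row_i inner p.1 (b i p.2).
have [m [s [sA sP]]] := finite_spanning (range l).
have hl i : exists q : H * H, l q = s i by have [q _ hq] := sA i; exists q.
have [p hp] := choice hl.
exists m, (fun j => (p j).2) => a; rewrite {1}ME => -[c _ <-] ah.
apply: bopP => h; apply: inner_sep => k.
have [d hd] := sP (l (k, h)) (ex_intro2 _ _ (k, h) I erefl).
have lE q : inner q.1 ((\sum_i c i *: b i) q.2) = \sum_i c i * l q 0 i.
  by rewrite bop_sumE inner_sumr; apply: eq_bigr => i _; rewrite innerZr mxE.
rewrite (lE (k, h)) hd.
under eq_bigr => i _ do rewrite summxE mulr_sumr.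
rewrite exchange_big big1 //= => j _.
under eq_bigr => i _ do rewrite mxE mulrCA.
by rewrite -mulr_sumr -hp -lE ah inner0r mulr0.
Qed.

Let vector_form (I : finType) (h : I -> H) (a b : bop H H) : R[i] :=
  \sum_j inner (a (h j)) (b (h j)).

Let vector_form_semi (I : finType) (h : I -> H) : semi_inner (vector_form h).
Proof.
split=> [x a y z|x y|x].
- rewrite /vector_form mulr_sumr -big_split; apply: eq_bigr => i _ /=.
  by rewrite innerDr innerZr.
- by rewrite /vector_form conjc_sum; apply: eq_bigr => i _; exact: inner_conj.
- by rewrite /vector_form sumr_ge0// => i _; exact: inner_ge0.
Qed.

Let vector_form_adj (I : finType) (h : I -> H) x y z :
  vector_form h (x \ob y) z = vector_form h y (adj x \ob z).
Proof. by apply: eq_bigr => j _ /=; rewrite adjr. Qed.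

Let vector_form_eq0 (I : finType) (h : I -> H) x j :
  vector_form h x x = 0 -> x (h j) = 0.
Proof.
move=> /eqP; rewrite psumr_eq0 => [/allP hx|i _]; last exact: inner_ge0.
by apply: inner_eq0; apply/eqP; have := hx j; rewrite mem_index_enum; exact.
Qed.

(** The form B1 is definite on M, so it has a Parseval family e; the trace of left
    multiplication by a on M is then sum_k B1 e_k (a e_k), and B2 x y is the trace
    of x^* y. Traciality is the identity B2 x y = B2 y^* x^*. For a Parseval
    family f of B2 it moves the matrix of multiplication by a in M from one side
    of sum_k f_k^* A f_k to the other. Finally c = sum_k f_k^* f_k satisfies
    B2 x c = B2 x 1 for all x in M, as both sides are the trace of
    multiplication by x^*, on the right and on the left. *)
Lemma averaging : exists (n : nat) (f : 'I_n -> bop H H),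
  [/\ forall k, M (f k),
      forall A, commutant M (\sum_k adj (f k) \ob A \ob f k) &
      \sum_k adj (f k) \ob f k = bid H].
Proof.
have [m [h hsep]] := separating_vectors.
have [n [b ME]] := hMfin.
pose B1 := vector_form h.
have B1s : semi_inner B1 := vector_form_semi h.
have B1l x y z : B1 (x \ob y) z = B1 y (adj x \ob z) by exact: vector_form_adj.
have nd1 x : M x -> B1 x x = 0 -> x = 0.
  by move=> Mx hx; apply: hsep => // j; exact: vector_form_eq0 hx.
have [e fe] := frame_exists B1s ME; have [Me eP] := fe.
have e_expand := frame_expand B1s sM nd1 fe.
pose B2 := vector_form (fun q : 'I_n * 'I_m => e q.1 (h q.2)).
have B2s : semi_inner B2 := vector_form_semi _.
have B2E x y : B2 x y = \sum_k B1 (x \ob e k) (y \ob e k).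
  by rewrite /B2 /B1 /vector_form pair_bigA.
have nd2 x : M x -> B2 x x = 0 -> x = 0.
  move=> Mx hx; have xe k j : x (e k (h j)) = 0.
    exact: (vector_form_eq0 (k, j) hx).
  apply: hsep => // j; rewrite -[h j]/(bid H (h j)) (e_expand _ M1) bop_sumE.
  by rewrite linear_sum big1// => k _; rewrite linearZ /= xe scaler0.
have [f ff] := frame_exists B2s ME; have [Mf fP] := ff.
have f_expand := frame_expand B2s sM nd2 ff.
have B2J x y : M x -> M y -> B2 x y = B2 (adj y) (adj x).
  move=> Mx My; rewrite !B2E.
  under eq_bigr => k _ do rewrite (eP _ (MM Mx (Me k))).
  under [RHS]eq_bigr => k _ do rewrite (eP _ (MM (MJ My) (Me k))).
  rewrite exchange_big; apply: eq_bigr => l _; apply: eq_bigr => k _ /=.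
  by rewrite mulrC !B1l adjK.
have B2l x y z : B2 (x \ob y) z = B2 y (adj x \ob z).
  exact: vector_form_adj.
have B2r x y z : M x -> M y -> M z -> B2 (y \ob x) z = B2 y (z \ob adj x).
  move=> Mx My Mz; rewrite B2J//; last exact: MM.
  by rewrite adj_comp -B2l B2J ?adj_comp ?adjK//; [apply: MM => //; exact: MJ|exact: MJ].
exists n, f; split=> // [A a Ma|].
- rewrite bcomp_suml bcomp_sumr; symmetry.
  pose g k l := B2 (f k) (f l \ob a).
  transitivity (\sum_k \sum_l g k l *: (adj (f l) \ob A \ob f k)).
    apply: eq_bigr => k _; rewrite !bcompA.
    have Mfa : M (f k \ob adj a) by apply: MM => //; exact: MJ.
    have -> : a \ob adj (f k) = adj (f k \ob adj a) by rewrite adj_comp adjK.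
    rewrite {1}(f_expand _ Mfa) adj_sum !bcomp_suml; apply: eq_bigr => l _.
    rewrite adjZ !bcompZl -(semi_conj B2s); congr (_ *: _).
    by rewrite (B2r _ _ _ _ (Mf k) (Mf l)) ?adjK//; exact: MJ.
  rewrite exchange_big; apply: eq_bigr => l _ /=.
  rewrite -bcompA (f_expand (f l \ob a)) ?bcomp_sumr; last exact: MM.
  by apply: eq_bigr => k _; rewrite bcompZr.
- set c := \sum_k _.
  have Mc : M c by apply: submod_sum => // k _; apply: MM => //; exact: MJ.
  have key x : M x -> B2 x c = B2 x (bid H).
    move=> Mx; rewrite (semi_sumr B2s).
    transitivity (\sum_k B2 (f k) (f k \ob adj x)).
      by apply: eq_bigr => k _; rewrite -{2}(adjK (f k)) -B2l adjK B2r.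
    transitivity (\sum_l B2 (f l) (adj x \ob f l)).
      have Mxf k : M (x \ob adj (f k)) by apply: MM => //; exact: MJ.
      have Mfx k : M (adj (f k) \ob x) by apply: MM => //; exact: MJ.
      transitivity (\sum_k \sum_l B2 (x \ob adj (f k)) (f l) * B2 (f l) (adj (f k))).
        apply: eq_bigr => k _; rewrite -fP// B2J//; last by apply: MM => //; exact: MJ.
        by rewrite adj_comp adjK.
      rewrite exchange_big; apply: eq_bigr => l _ /=.
      transitivity (\sum_k B2 (adj (f l) \ob x) (f k) * B2 (f k) (adj (f l))).
        apply: eq_bigr => k _; rewrite B2J// adj_comp adjK B2r//; last exact: MJ.
        by rewrite [B2 (f l) _]B2J ?adjK//; exact: MJ.
      by rewrite -fP// B2J// ?adj_comp ?adjK//; exact: MJ.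
    transitivity (\sum_k B1 (e k) (adj x \ob e k)); last first.
      by rewrite B2E; apply: eq_bigr => k _; rewrite bcomp1l B1l.
    transitivity (\sum_l \sum_k B1 (e k) (f l) * B2 (f l) (adj x \ob e k)).
      apply: eq_bigr => l _; rewrite {2}(e_expand _ (Mf l)) bcomp_sumr.
      rewrite (semi_sumr B2s); apply: eq_bigr => k _.
      by rewrite bcompZr (semiZr B2s).
    rewrite exchange_big; apply: eq_bigr => k _ /=.
    rewrite {2}(f_expand (adj x \ob e k)); last by apply: MM => //; exact: MJ.
    rewrite (semi_sumr B1s); apply: eq_bigr => l _.
    by rewrite (semiZr B1s) mulrC.
  apply/eqP; rewrite -subr_eq0; apply/eqP; apply: nd2; first exact: submodB.
  have Mc1 : M (c - bid H) by exact: submodB.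
  by rewrite (semiBr B2s) key// subrr.
Qed.
End Averaging.


(** * A dominated relation is spanned by completely positive maps *)

Lemma conjc_i (R : realType) : ('i%C : R[i])^J = - 'i%C.
Proof. by apply/eqP; rewrite eq_complex /= oppr0 !eqxx. Qed.

Lemma half_twice (R : realType) (W : lmodType R[i]) (w : W) :
  2^-1 *: (w + w) = w.
Proof.
rewrite scalerDr -scalerDl (_ : _ + _ = 1) ?scale1r//.
by field.
Qed.

(** The map is only assumed sesquilinear, with values in any module: it serves
    both for the form of an operator and for operator-valued products. *)
Lemma polarization (R : realType) (U W : lmodType R[i]) (q : U -> U -> W)
    (P : set W) : submod P ->
  (forall u v w, q (u + v) w = q u w + q v w) ->
  (forall u v w, q u (v + w) = q u v + q u w) ->
  (forall a u v, q (a *: u) v = a^J *: q u v) ->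
  (forall a u v, q u (a *: v) = a *: q u v) ->
  (forall u, P (q u u)) -> forall u v, P (q u v).
Proof.
move=> sP qDl qDr qZl qZr hq u v.
have ii : 'i%C * 'i%C = -1 :> R[i] by rewrite -expr2 sqr_i.
have -> : q u v = 2^-1 *: ((q (u + v) (u + v) - q u u - q v v) -
    'i%C *: (q (u + 'i%C *: v) (u + 'i%C *: v) - q u u - q ('i%C *: v) ('i%C *: v))).
  have h1 x y : q (x + y) (x + y) - q x x - q y y = q x y + q y x.
    by rewrite !qDl !qDr -[X in X - _ - _]addrA [X in X - _ - _]addrC addrK addrA addrK.
  rewrite !h1 qZl qZr conjc_i scaleNr -scalerBr scalerA ii scaleN1r opprK.
  by rewrite addrACA subrr addr0 half_twice.
apply: submodZ => //; apply: submodB => //; last apply: submodZ => //.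
  by do 2?[apply: submodB => //].
by do 2?[apply: submodB => //].
Qed.

Section KrausSpan.
Context {R : realType} {H : hilbertType R}.

Lemma pos_self_adjoint (x : bop H H) : op_le 0 x -> self_adjoint x.
Proof.
move=> hx; apply/self_adjointP/esym/eqP; rewrite -subr_eq0; apply/eqP.
apply: bopP => k; apply: inner_sep => h.
have := @polarization R H R[i]^o (fun u v => inner u ((x - adj x) v) : R[i]^o) [set 0].
move=> /(_ _ _ _ _ _ _ h k); apply.
- split=> //= a u v -> ->; by rewrite scaler0 addr0.
- by move=> u v w; rewrite innerDl.
- by move=> u v w; rewrite linearD innerDr.
- by move=> a u v; rewrite innerZl.
- by move=> a u v; rewrite linearZ innerZr.
move=> u /=; rewrite innerBr adjr (inner_conj u).
have := hx u; rewrite subr0 => /conjc_ge0 ->; exact: subrr.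
Qed.

Lemma rank1Dl (K : hilbertType R) (u v : K) (w : H) :
  rank1 (u + v) w = rank1 u w + rank1 v w.
Proof. by apply: bopP => h; rewrite bopDE !rank1E scalerDr. Qed.
Lemma rank1Dr (K : hilbertType R) (u v : H) (w : K) :
  rank1 w (u + v) = rank1 w u + rank1 w v.
Proof. by apply: bopP => h; rewrite bopDE !rank1E innerDl scalerDl. Qed.
Lemma rank1_suml (K : hilbertType R) (I : finType) (F : I -> K) (w : H) :
  rank1 (\sum_i F i) w = \sum_i rank1 (F i) w.
Proof.
apply: bopP => h; rewrite rank1E bop_sumE scaler_sumr.
by apply: eq_bigr => i _; rewrite rank1E.
Qed.
Lemma rank1_sumr (K : hilbertType R) (I : finType) (F : I -> H) (w : K) :
  rank1 w (\sum_i F i) = \sum_i rank1 w (F i).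
Proof.
apply: bopP => h; rewrite rank1E bop_sumE inner_suml scaler_suml.
by apply: eq_bigr => i _; rewrite rank1E.
Qed.
Lemma rank1Zl (K : hilbertType R) a (u : K) (w : H) :
  rank1 (a *: u) w = a *: rank1 u w.
Proof. by apply: bopP => h; rewrite bopZE !rank1E !scalerA mulrC. Qed.
Lemma rank1Zr (K : hilbertType R) a (u : K) (w : H) :
  rank1 u (a *: w) = a^J *: rank1 u w.
Proof. by apply: bopP => h; rewrite bopZE !rank1E innerZl scalerA. Qed.
Variables (M S : set (bop H H)).
Hypotheses (hM : von_neumann M) (hMfin : finite_dim M).
Hypotheses (hS : quantum_relation M M S) (hSadj : S = adj_set S).

(** If x = x^* in S, then x + t x0 and t x0 are positive elements of S for t large;
    general elements of S are combinations of self-adjoint ones as S = S^*. *)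
Lemma span_positive (x0 : bop H H) (W : set (bop H H)) : dominating M S x0 ->
  submod W -> (forall y, S y -> op_le 0 y -> W y) -> S `<=` W.
Proof.
move=> [x0p [Sx0 _] dom] sW hW.
have [[sS _] _] := hS; rewrite subspace_submod in sS.
have Sadj x : S x -> S (adj x).
  by move=> Sx; rewrite hSadj; exists x => //; exact: adjP.
have Wsa x : S x -> adj x = x -> W x.
  move=> Sx xsa; have [t t0 [ht _]] := dom x Sx ((self_adjointP x).2 xsa).
  have -> : x = (x + t%:C *: x0) - t%:C *: x0 by rewrite addrK.
  apply: submodB => //; apply: hW.
  - by apply: submodD => //; apply: submodZ.
  - by move=> h; have := ht h; rewrite opprK subr0.
  - exact: submodZ.
  - move=> h; rewrite subr0 bopZE innerZr; apply: mulr_ge0.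
      by rewrite ler0c ltW.
    by have := x0p h; rewrite subr0.
move=> x Sx; have Sxa := Sadj x Sx.
have ii : 'i%C * 'i%C = -1 :> R[i] by rewrite -expr2 sqr_i.
have -> : x = 2^-1 *: ((x + adj x) - 'i%C *: ('i%C *: (x - adj x))).
  rewrite scalerA ii scaleN1r opprK addrACA subrr addr0.
  by rewrite half_twice.
apply: submodZ => //; apply: submodB => //; last apply: submodZ => //.
  by apply: Wsa; [exact: submodD|rewrite adjD adjK addrC].
apply: Wsa; first by apply: submodZ => //; exact: submodB.
by rewrite adjZ adjD adjN adjK conjc_i scaleNr -scalerN opprB.
Qed.

(** The operators E(|xi><a|) y E(|b><eta|) depend on y, a and b only through a
    scalar matrix. For a = b and y >= 0 this matrix is the Gram matrix of the
    vectors f_k^* a for the form <u, y v>, which provides the factorisation into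
    the g_ij. The case of distinct a and b follows by polarization. Then
    [rank1_total] is applied on each side of y to replace the rank-one operators
    by 1, and E(1) = 1. *)
Lemma kraus_span (x0 : bop H H) : dominating M S x0 ->
  exists (m n : nat) (g : 'I_m -> 'I_n -> bop H H),
    (forall i j, M (g i j)) /\
    S = closed_span [set x | exists i xi eta,
          x = \sum_j rank1 (adj (g i j) xi) (adj (g i j) eta)].
Proof.
move=> hdom; have [[sS cS] bimod] := hS; rewrite subspace_submod in sS.
have [n [f [Mf EM E1]]] := averaging hM hMfin.
pose E A := \sum_k adj (f k) \ob A \ob f k.
have Enorm (c d : bop H H) : normal_map (fun A => c \ob E A \ob d).
  rewrite (_ : (fun A => _) = fun A => \sum_k (c \ob adj (f k)) \ob A \ob (f k \ob d)).
    by apply: normal_map_sum => k _; exact: normal_map_comp.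
  apply/funext => A; rewrite bcomp_sumr bcomp_suml; apply: eq_bigr => k _.
  by rewrite !bcompA.
have Ebid : E (bid H) = bid H.
  by rewrite -{2}E1; apply: eq_bigr => k _; rewrite bcomp1r.
have ED A B : E (A + B) = E A + E B.
  by rewrite -big_split; apply: eq_bigr => k _; rewrite /= bcompDr bcompDl.
have EZ c A : E (c *: A) = c *: E A.
  by rewrite scaler_sumr; apply: eq_bigr => k _; rewrite bcompZr bcompZl.
have EyE y xi al be eta : E (rank1 xi al) \ob y \ob E (rank1 be eta) =
    \sum_k \sum_l inner (adj (f k) al) (y (adj (f l) be)) *:
      rank1 (adj (f k) xi) (adj (f l) eta).
  rewrite bcomp_suml bcomp_suml; apply: eq_bigr => k _.
  rewrite bcomp_sumr; apply: eq_bigr => l _.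
  by rewrite !comp_rank1l !comp_rank1r adj_rank1 rank1E rank1Zr -inner_conj adjl.
have SEyE y A B : S y -> S (E A \ob y \ob E B).
  by move=> Sy; apply: bimod => //; exact: EM.
pose X y al : 'rV[R[i]]_(n * n) :=
  mxvec (\matrix_(k, l) inner (adj (f k) al) (y (adj (f l) al))).
have [m [s [sA sP]]] := finite_spanning
  [set x | exists y al, [/\ S y, op_le 0 y & x = X y al]].
(* Each of the finitely many spanning matrices comes from some yy i and aa i. *)
have [yy hy] := choice sA; have {hy}[aa hy] := choice hy.
have fac i : exists G : 'I_n -> 'I_n -> R[i], forall k l,
    inner (adj (f k) (aa i)) (yy i (adj (f l) (aa i))) =
    \sum_j (G j k)^J * G j l.
  have [_ yp _] := hy i; have ysa := pos_self_adjoint yp.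
  have Qs : semi_inner (fun u v => inner u (yy i v)).
    split=> [u a v w|u v|u].
    - by rewrite linearP innerDr innerZr.
    - by rewrite ysa inner_conj.
    - by have := yp u; rewrite subr0.
  pose b (l : nat) := if insub l is Some k then adj (f k) (aa i) else 0.
  have bE (k : 'I_n) : b k = adj (f k) (aa i) by rewrite /b valK.
  have [e [_ eP]] := parseval_frame Qs n b.
  exists (fun j l => inner (e j) (yy i (adj (f l) (aa i)))) => k l.
  rewrite -bE (eP k (ltn_ord k)); apply: eq_bigr => j _.
  by rewrite bE; congr (_ * _); rewrite -inner_conj -ysa.
have [G hG] := choice fac.
pose g i j := \sum_l G i j l *: f l.
have gE i j xi : adj (g i j) xi = \sum_l (G i j l)^J *: adj (f l) xi.
  by rewrite adj_sum bop_sumE; apply: eq_bigr => l _; rewrite adjZ.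
have gsum i xi eta :
    \sum_j rank1 (adj (g i j) xi) (adj (g i j) eta) =
    E (rank1 xi (aa i)) \ob yy i \ob E (rank1 (aa i) eta).
  rewrite EyE; under eq_bigr => j _.
    rewrite !gE rank1_suml.
    under eq_bigr => k _.
      rewrite rank1_sumr.
      under eq_bigr => l _ do rewrite rank1Zl rank1Zr conjcK scalerA.
      over.
    over.
  rewrite exchange_big; apply: eq_bigr => k _ /=.
  rewrite exchange_big; apply: eq_bigr => l _ /=.
  by rewrite -scaler_suml hG.
exists m, n, g; split.
  have [[sM _] _ _ _] := hM; rewrite subspace_submod in sM.
  by move=> i j; apply: submod_sum => // l _; exact: submodZ.
set gens := [set x | _]; have clW := closed_span_closed gens.
have gW := @sub_closed_span _ _ gens; have gmin := @closed_span_sub _ _ gens.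
move: (closed_span gens) clW gW gmin => W clW gW gmin.
have [sW _] := clW; rewrite subspace_submod in sW.
apply/seteqP; split; last first.
  apply: gmin => [|_ [i [xi [eta ->]]]]; first by split.
  by rewrite gsum; apply: SEyE; have [] := hy i.
apply: (span_positive hdom sW) => y Sy yp.
have diag al xi eta : W (E (rank1 xi al) \ob y \ob E (rank1 al eta)).
  have [c cE] := sP _ (ex_intro _ y (ex_intro _ al (And3 Sy yp erefl))).
  have -> : E (rank1 xi al) \ob y \ob E (rank1 al eta) =
      \sum_i c i *: \sum_j rank1 (adj (g i j) xi) (adj (g i j) eta).
    rewrite EyE; under [RHS]eq_bigr => i _.
      rewrite gsum EyE scaler_sumr.
      under eq_bigr => k _ do rewrite scaler_sumr.
      over.
    rewrite [RHS]exchange_big; apply: eq_bigr => k _ /=.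
    rewrite [RHS]exchange_big; apply: eq_bigr => l _ /=.
    under [RHS]eq_bigr => i _ do rewrite scalerA.
    rewrite -scaler_suml; congr (_ *: _).
    have /rowP/(_ (mxvec_index k l)) := cE; rewrite mxvecE mxE => ->.
    rewrite summxE; apply: eq_bigr => i _; have [_ _ ->] := hy i.
    by rewrite mxE mxvecE mxE.
  apply: submod_sum => // i _; apply: submodZ => //; apply: gW.
  by exists i, xi, eta.
have off a b : W (E (rank1 a a) \ob y \ob E (rank1 b b)).
  apply: (@polarization R H (bop H H)
    (fun u v => E (rank1 a u) \ob y \ob E (rank1 v b)) W) => //.
  - by move=> u v w; rewrite rank1Dr ED bcompDl bcompDl.
  - by move=> u v w; rewrite rank1Dl ED bcompDr.
  - by move=> c u v; rewrite rank1Zr EZ !bcompZl.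
  - by move=> c u v; rewrite rank1Zl EZ bcompZr.
have half b : W (y \ob E (rank1 b b)).
  have := normal_map_preimage (Enorm (bid H) (y \ob E (rank1 b b))) clW.
  move=> /rank1_total; rewrite /preimage /= Ebid !bcomp1l; apply => a.
  by rewrite bcomp1l bcompA; exact: off.
have := normal_map_preimage (Enorm y (bid H)) clW.
move=> /rank1_total; rewrite /preimage /= Ebid !bcomp1r; apply => b.
by rewrite bcomp1r; exact: half.
Qed.

End KrausSpan.


(** * Block-diagonal matrices *)

(** Coordinates in a Parseval family of the span of the vectors. *)
Lemma gram_factor (R : realType) (H : hilbertType R) (J : finType) (u : J -> H) :
  exists (N : nat) (c : 'I_N -> J -> R[i]), forall a b,
    inner (u a) (u b) = \sum_r (c r a)^J * c r b.
Proof.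
pose b (k : nat) := if insub k is Some i then u (enum_val (i : 'I_#|J|)) else 0.
have bE a : b (enum_rank a) = u a by rewrite /b valK enum_rankK.
have [e [_ eP]] := parseval_frame (inner_semi H) #|J| b.
exists #|J|, (fun r a => inner (e r) (u a)) => a a'.
rewrite -(bE a) (eP _ (ltn_ord _)); apply: eq_bigr => r _.
by rewrite -inner_conj.
Qed.

Section Matrices.
Context {R : realType} {I : finType}.
Local Notation K := (l2sum I (cplx R)).

Definition unit_vec (q : I) : K := [ffun p => ((p == q)%:R : R[i])].

Lemma l2_expand (k : K) : k = \sum_q (k q : R[i]) *: unit_vec q.
Proof.
apply/ffunP => p; rewrite sum_ffunE (bigD1 p)//= big1 ?addr0; last first.
  by move=> q qp; rewrite !ffunE eq_sym (negbTE qp); exact: mulr0.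
by rewrite !ffunE eqxx; symmetry; exact: mulr1.
Qed.

Definition entry (x : bop K K) (p q : I) : R[i] := (x (unit_vec q)) p.

Lemma entryE (x : bop K K) (k : K) p :
  x k p = \sum_q entry x p q * (k q : R[i]) :> R[i].
Proof.
rewrite [in LHS](l2_expand k) linear_sum sum_ffunE; apply: eq_bigr => q _.
by rewrite linearZ !ffunE /=; exact: mulrC.
Qed.

Lemma inner_unit_vec p (k : K) : inner (unit_vec p) k = (k p : R[i]).
Proof.
rewrite inner_l2 (bigD1 p)//= big1 ?addr0 => [|q qp].
  by rewrite inner_cplx ffunE eqxx conjc1 mul1r.
by rewrite inner_cplx ffunE (negbTE qp) conjc0 mul0r.
Qed.

Lemma inner_entry (x : bop K K) (k k' : K) : inner k (x k') =
  \sum_p \sum_q (k p : R[i])^J * (entry x p q * (k' q : R[i])).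
Proof.
rewrite inner_l2; apply: eq_bigr => p _.
by rewrite inner_cplx entryE mulr_sumr.
Qed.

Lemma entry_ext (x y : bop K K) : (forall p q, entry x p q = entry y p q) -> x = y.
Proof.
move=> h; apply: bopP => k; apply/ffunP => p.
by rewrite !entryE; apply: eq_bigr => q _; rewrite h.
Qed.

Lemma entry_linear a (x y : bop K K) p q :
  entry (a *: x + y) p q = a * entry x p q + entry y p q.
Proof. by rewrite /entry bopDE bopZE !ffunE. Qed.

Lemma entry_comp (x y : bop K K) p q :
  entry (x \ob y) p q = \sum_r entry x p r * entry y r q.
Proof. exact: (entryE x (y (unit_vec q)) p). Qed.

Lemma entry_adj (x : bop K K) p q : entry (adj x) p q = (entry x q p)^J.
Proof.
by rewrite /entry -!inner_unit_vec adjr -inner_conj.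
Qed.

Lemma entry_unit p q a b :
  entry (rank1 (unit_vec p) (unit_vec q)) a b = ((a == p) && (q == b))%:R.
Proof.
rewrite /entry rank1E inner_unit_vec !ffunE; case: eqP => _; case: eqP => _ /=;
  by [exact: mulr1|exact: mulr0|exact: mul0r].
Qed.

Lemma entry_id p q : entry (bid K) p q = (p == q)%:R.
Proof. by rewrite /entry ffunE. Qed.

Lemma entry_normal p q : normal_functional (fun x : bop K K => entry x p q : R[i]^o).
Proof.
have := normal_rank (unit_vec q) (unit_vec p).
by congr normal_functional; apply/funext => x; rewrite inner_unit_vec.
Qed.

Lemma entry_sum (J : finType) (c : J -> R[i]) (x : J -> bop K K) p q :
  entry (\sum_j c j *: x j) p q = \sum_j c j * entry (x j) p q.
Proof.
rewrite /entry bop_sumE sum_ffunE; apply: eq_bigr => j _.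
by rewrite bopZE !ffunE.
Qed.

Lemma entry_matrix (x : bop K K) :
  x = \sum_(r : I * I) entry x r.1 r.2 *: rank1 (unit_vec r.1) (unit_vec r.2).
Proof.
apply: entry_ext => p q; rewrite entry_sum (bigD1 (p, q))//= big1 ?addr0.
  by rewrite entry_unit !eqxx mulr1.
move=> [a b] ab; rewrite entry_unit /=.
case: eqP => [pa|_] /=; last by rewrite mulr0.
case: eqP => [bq|_]; last by rewrite mulr0.
by rewrite pa bq eqxx in ab.
Qed.

Context {J : eqType} (bl : I -> J).

(** The blocks are the fibres of bl. *)
Definition block_diagonal : set (bop K K) :=
  [set x | forall p q, bl p != bl q -> entry x p q = 0].

Lemma block_diagonal_vN : von_neumann block_diagonal.
Proof.
split.
- rewrite (_ : block_diagonal = \bigcap_(r in [set r : I * I | bl r.1 != bl r.2])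
    [set x | (entry x r.1 r.2 : R[i]^o) = 0]).
    apply: closed_subspace_bigcap => r _.
    exact: (closed_subspace_normal_ker (entry_normal r.1 r.2)).
  by apply/seteqP; split=> [x hx [p q] /=|x hx p q pq]; [exact: hx|exact: (hx (p, q))].
- by move=> p q pq; rewrite entry_id; have [e|//] := eqVneq p q; rewrite e eqxx in pq.
- move=> x y hx hy p q pq; rewrite entry_comp big1// => r _.
  have [pr|pr] := eqVneq (bl p) (bl r); last by rewrite hx// mul0r.
  by rewrite hy ?mulr0// -pr.
- move=> x w hx /adj_uniq -> p q pq.
  by rewrite entry_adj hx ?conjc0// eq_sym.
Qed.

Lemma block_diagonal_unit p q : bl p = bl q ->
  block_diagonal (rank1 (unit_vec p) (unit_vec q)).
Proof.
move=> pq a b ab; rewrite entry_unit.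
by case: eqP => // ap; case: eqP => // qb; rewrite ap -qb pq eqxx in ab.
Qed.

Lemma block_diagonal_finite : finite_dim block_diagonal.
Proof.
pose u (r : I * I) : bop K K :=
  if bl r.1 == bl r.2 then rank1 (unit_vec r.1) (unit_vec r.2) else 0.
exists #|{: I * I}|, (fun i => u (enum_val i)); apply/seteqP; split=> [x hx|_ [c _ <-]].
  exists (fun i => entry x (enum_val i).1 (enum_val i).2) => //.
  rewrite [RHS]entry_matrix [RHS](reindex (@enum_val _ {: I * I})) /=; last first.
    exact/onW_bij/enum_val_bij.
  apply: eq_bigr => i _; rewrite /u; case: eqP => // /eqP h.
  by rewrite hx// !scale0r.
have [[sN _] _ _ _] := block_diagonal_vN; rewrite subspace_submod in sN.
move: (block_diagonal) sN (@block_diagonal_unit) => N sN hN.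
apply: submod_sum => // i _; apply: submodZ => //; rewrite /u.
by case: eqP => [/hN//|_]; have [] := sN.
Qed.

(** Commuting with the matrix unit at (p, q), for p and q in the same block,
    compares row r of z at p with its diagonal entry at q. *)
Lemma block_commutantP (z : bop K K) : commutant block_diagonal z ->
  (forall p q, p != q -> entry z p q = 0) /\
  (forall p q, bl p = bl q -> entry z p p = entry z q q).
Proof.
move=> hz.
have key p q r : bl p = bl q -> entry z r p = (r == p)%:R * entry z q q.
  move=> pq; have := congr1 (fun y => entry y r q) (hz _ (block_diagonal_unit pq)).
  rewrite !entry_comp (bigD1 p)//= big1 ?addr0 => [|a ap]; last first.
    by rewrite entry_unit (negbTE ap) mulr0.
  rewrite entry_unit !eqxx mulr1 => ->.
  rewrite (bigD1 q)//= big1 ?addr0 => [|a aq]; last first.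
    by rewrite entry_unit [q == a]eq_sym (negbTE aq) andbF mul0r.
  by rewrite entry_unit eqxx andbT.
split=> [p q pq|p q pq]; first by rewrite (key q q p)// (negbTE pq) mul0r.
by rewrite (key p q p)// eqxx mul1r.
Qed.

Definition block_proj (i : J) : bop K K :=
  \sum_(p | bl p == i) rank1 (unit_vec p) (unit_vec p).

Lemma block_projE i (k : K) p :
  block_proj i k p = (if bl p == i then k p else 0) :> R[i].
Proof.
rewrite /block_proj bop_sumE sum_ffunE.
under eq_bigr => q _ do rewrite rank1E inner_unit_vec !ffunE.
have [hp|hp] := boolP (bl p == i).
  rewrite (bigD1 p)//= big1 ?addr0 => [|q /andP[_ qp]].
    by rewrite eqxx; exact: mulr1.
  by rewrite eq_sym (negbTE qp); exact: mulr0.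
rewrite big1// => q hq; case: eqP => [pq|_]; last exact: mulr0.
by rewrite pq hq in hp.
Qed.

Lemma block_proj_commutant i : commutant block_diagonal (block_proj i).
Proof.
move=> x hx; apply: entry_ext => p q.
rewrite /entry /= block_projE [in RHS]entryE.
have -> : \sum_r entry x p r * (block_proj i (unit_vec q) r : R[i]) =
    entry x p q * (bl q == i)%:R.
  rewrite (bigD1 q)//= big1 ?addr0 => [|r rq].
    by rewrite block_projE ffunE eqxx; case: ifP.
  by rewrite block_projE ffunE (negbTE rq); case: ifP => _; exact: mulr0.
have [pq|pq] := eqVneq (bl p) (bl q); last first.
  rewrite hx// mul0r; case: ifP => // _.
  exact: hx.
by rewrite pq; case: ifP => _; rewrite ?mulr1 ?mulr0.
Qed.

End Matrices.


(** * The completely positive map of a finite family *)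

Section Construction.
Context {R : realType} {H : hilbertType R} {I J : finType} (bl : I -> J).
Context (g : I -> bop H H).
Local Notation K := (l2sum I (cplx R)).
Local Notation T := (l2sum I H).

Definition l2_tensor (k : K) (h : H) : T := [ffun p => (k p : R[i]) *: h].

Lemma l2_tensorP : hilbert_tensor l2_tensor.
Proof.
split=> [l a x y|k a x y|k k' l l'|].
- by apply/ffunP => p; rewrite !ffunE scalerA -scalerDl.
- by apply/ffunP => p; rewrite !ffunE scalerDr !scalerA mulrC.
- rewrite !inner_l2 mulr_suml; apply: eq_bigr => p _.
  by rewrite !ffunE innerZl innerZr inner_cplx mulrA.
apply/seteqP; split=> // t _.
have -> : t = \sum_p l2_tensor (unit_vec p) (t p).
  apply/ffunP => q; rewrite sum_ffunE (bigD1 q)//= big1 ?addr0 => [|p pq].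
    by rewrite !ffunE eqxx scale1r.
  by rewrite !ffunE eq_sym (negbTE pq) scale0r.
set A := [set _ | _ in _ & _ in _].
have [[sA _] hA] := (closed_span_closed A, @sub_closed_span _ _ A).
rewrite subspace_submod in sA; move: (closed_span A) sA hA => W sW AW.
by apply: submod_sum => // p _; apply: AW; exists (unit_vec p) => //; exists (t p).
Qed.

(** This is v^* (y (x) 1) v for v h = (g_p h)_p in [l2sum I H], which is the
    tensor product of [l2sum I (cplx R)] and H. *)
Definition kraus_map (y : bop K K) : bop H H :=
  \sum_p \sum_q entry y p q *: (adj (g p) \ob g q).

Lemma kraus_map_normal : normal_map kraus_map.
Proof.
apply: normal_map_sum => p _; apply: normal_map_sum => q _.
split=> [a x y|w hw]; first by rewrite entry_linear scalerDl scalerA.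
set c := adj (g p) \ob g q.
rewrite (_ : _ \o _ = (w c : R[i]^o) *: (fun y => entry y p q : R[i]^o)).
  move=> y; apply: continuousZr; exact: (normal_continuous (entry_normal p q)).
by apply/funext => y; rewrite /= normalZ//; exact: mulrC.
Qed.

(** The vectors g_p h_i have a Gram matrix sum_r conj(c_r) c_r, so the form at
    (h_i) is the sum over r of the forms of the matrix a at the vectors c_r of
    K^n. *)
Lemma kraus_map_cp N : completely_positive N kraus_map.
Proof.
move=> n a _ apos h.
have [m [c hc]] := gram_factor (fun r : 'I_n * I => g r.2 (h r.1)).
have -> : \sum_i \sum_j inner (h i) (kraus_map (a i j) (h j)) =
    \sum_(r < m) \sum_i \sum_j
      inner ([ffun p => c r (i, p)] : K) (a i j ([ffun p => c r (j, p)] : K)).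
  transitivity (\sum_i \sum_j \sum_p \sum_q \sum_(r < m)
      (c r (i, p))^J * (entry (a i j) p q * c r (j, q))).
    apply: eq_bigr => i _; apply: eq_bigr => j _.
    rewrite bop_sumE inner_sumr; apply: eq_bigr => p _.
    rewrite bop_sumE inner_sumr; apply: eq_bigr => q _.
    rewrite bopZE innerZr /= adjr (hc (i, p) (j, q)) mulr_sumr.
    by apply: eq_bigr => r _; rewrite mulrCA.
  symmetry; rewrite exchange_big; apply: eq_bigr => i _.
  rewrite exchange_big; apply: eq_bigr => j _.
  under eq_bigr => r _ do rewrite inner_entry.
  rewrite exchange_big; apply: eq_bigr => p _.
  rewrite exchange_big; apply: eq_bigr => q _.
  by apply: eq_bigr => r _; rewrite !ffunE.
by apply: sumr_ge0 => r _; exact: (apos (fun i => [ffun p => c r (i, p)])).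
Qed.

Variables (M S : set (bop H H)).
Hypotheses (hM : von_neumann M) (Mg : forall p, M (g p)).
Hypotheses (clS : closed_subspace S) (SJ : forall x, S x -> S (adj x)).
Hypothesis SE : S = closed_span [set x | exists i xi eta,
  x = \sum_(p | bl p == i) rank1 (adj (g p) xi) (adj (g p) eta)].

(** V is generated by the maps h |-> y' (<xi, g_p h>)_p. Since N' consists of
    block scalars, the product of the adjoint of one generator with another one
    is a combination, over the blocks i, of the given generators of S; taking for
    y' the projection onto the block i gives each of these generators alone. *)
Lemma kraus_arises : arises_from M S (block_diagonal bl) kraus_map.
Proof.
have ht := l2_tensorP.
have [[sM _] _ MM MJ] := hM; rewrite subspace_submod in sM.
split; first exact: block_diagonal_vN.
  split.
  - move=> y _; apply: submod_sum => // p _; apply: submod_sum => // q _.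
    by apply: submodZ => //; apply: MM => //; apply: (MJ (g p)) => //; exact: adjP.
  - by move=> c x y _ _; have [lin _] := kraus_map_normal; exact: lin.
  - exact: kraus_map_cp.
  - apply: continuous_subspaceT; exact: normal_map_continuous kraus_map_normal.
have incE p : exists f : bop H T, forall h, f h = l2_tensor (unit_vec p) h.
  apply: bop_exists => [a x y|]; first exact: (tensor_linearr ht).
  exists (complex.Re `|unit_vec p : K|) => h.
  by rewrite (tensor_norm ht) RRe_real// ger0_real.
have {incE}[inc hinc] := choice incE.
have incJ p t : adj (inc p) t = t p.
  apply: inner_inj => h; rewrite adjr hinc inner_l2 (bigD1 p)//= big1 ?addr0.
    by rewrite !ffunE eqxx scale1r.
  by move=> q qp; rewrite !ffunE (negbTE qp) scale0r inner0l.
pose v := \sum_p inc p \ob g p.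
have vE h q : v h q = g q h.
  rewrite bop_sumE sum_ffunE (bigD1 q)//= big1 ?addr0 => [|p pq] /=.
    by rewrite hinc !ffunE eqxx scale1r.
  by rewrite hinc !ffunE eq_sym (negbTE pq) scale0r.
clearbody v.
have sliceE xi P : is_slice l2_tensor xi P -> forall t q,
    (P t : K) q = inner xi (t q) :> R[i].
  move=> hP t q; rewrite -inner_unit_vec -[P]adjK adjr (slice_adj ht _ hP) inner_l2.
  rewrite (bigD1 q)//= big1 ?addr0 => [|p pq]; rewrite !ffunE.
    by rewrite eqxx scale1r.
  by rewrite (negbTE pq) scale0r inner0l.
pose gens := [set x : bop H K | exists (y' : bop K K) (xi : H) (P : bop T K),
  [/\ commutant (block_diagonal bl) y', is_slice l2_tensor xi P &
      x = y' \ob P \ob v]].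
have clV := closed_span_closed gens.
exists (closed_span gens).
  exists H, T, l2_tensor, v; split=> //.
  exists (adj v); first exact: adjP.
  move=> y _; pose Y := \sum_p \sum_q entry y p q *: (inc p \ob adj (inc q)).
  exists Y => [k h|].
    apply/ffunP => r; rewrite bop_sumE sum_ffunE (bigD1 r)//= [X in _ + X]big1 ?addr0.
      rewrite bop_sumE sum_ffunE ffunE entryE scaler_suml.
      apply: eq_bigr => q _; rewrite bopZE /= incJ hinc !ffunE eqxx scale1r.
      by rewrite scalerA.
    move=> p pr; rewrite bop_sumE sum_ffunE big1// => q _.
    by rewrite bopZE /= hinc !ffunE eq_sym (negbTE pr) scale0r scaler0.
  rewrite bcomp_sumr bcomp_suml; apply: eq_bigr => p _.
  rewrite bcomp_sumr bcomp_suml; apply: eq_bigr => q _.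
  rewrite bcompZr bcompZl; congr (_ *: _); apply: bopP => h.
  apply: inner_inj => z; rewrite /= !adjr incJ vE hinc inner_l2.
  rewrite (bigD1 p)//= big1 ?addr0 => [|r rp]; rewrite !ffunE.
    by rewrite eqxx scale1r vE.
  by rewrite (negbTE rp) scale0r inner0r.
have pairE (y1 y2 : bop K K) xi eta P Q (h h' : H) :
    is_slice l2_tensor xi P -> is_slice l2_tensor eta Q ->
    inner h ((adj (y1 \ob P \ob v) \ob (y2 \ob Q \ob v)) h') =
    \sum_p \sum_q (inner xi (g p h))^J *
      (entry (adj y1 \ob y2) p q * inner eta (g q h')).
  move=> hP hQ; rewrite /= adjr /= -adjr.
  rewrite -[adj y1 _]/((adj y1 \ob y2) _) inner_entry.
  apply: eq_bigr => p _; apply: eq_bigr => q _.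
  by rewrite (sliceE xi)// (sliceE eta)// !vE.
have blockE i xi eta h h' :
    inner h ((\sum_(p | bl p == i) rank1 (adj (g p) xi) (adj (g p) eta)) h') =
    \sum_(p | bl p == i) (inner xi (g p h))^J * inner eta (g p h').
  rewrite bop_sumE inner_sumr; apply: eq_bigr => p _.
  by rewrite rank1E innerZr adjl adjr mulrC -inner_conj.
have comJ (y : bop K K) :
    commutant (block_diagonal bl) y -> commutant (block_diagonal bl) (adj y).
  move=> hy x Nx; rewrite -[x]adjK -!adj_comp hy//.
  have [_ _ _ h] := block_diagonal_vN (R := R) bl.
  exact: (h x _ Nx (adjP x)).
have comM (y y' : bop K K) :
    commutant (block_diagonal bl) y -> commutant (block_diagonal bl) y' ->
    commutant (block_diagonal bl) (y \ob y').
  by move=> hy hy' x Nx; rewrite -bcompA hy'// bcompA hy// bcompA.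
have [sS cS] := clS; rewrite subspace_submod in sS.
have gensS a b : gens a -> gens b -> S (adj a \ob b).
  move=> [y1 [xi [P [c1 hP ->]]]] [y2 [eta [Q [c2 hQ ->]]]].
  have [z0 zc] := block_commutantP (comM _ _ (comJ _ c1) c2).
  (* la i is the scalar by which y1^* y2 acts on the block i *)
  have [la hla] : exists la : J -> R[i], forall p, entry (adj y1 \ob y2) p p = la (bl p).
    exists (fun i => if [pick p | bl p == i] is Some p
      then entry (adj y1 \ob y2) p p else 0).
    move=> p; case: pickP => [q /eqP qp|/(_ p)]; first by apply: zc.
    by rewrite eqxx.
  rewrite (_ : _ \ob _ = \sum_i la i *:
      \sum_(p | bl p == i) rank1 (adj (g p) xi) (adj (g p) eta)).
    have gS : forall i, S (\sum_(p | bl p == i) rank1 (adj (g p) xi) (adj (g p) eta)).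
      by move=> i; rewrite SE; apply: sub_closed_span; exists i, xi, eta.
    by apply: submod_sum => // i _; exact: submodZ.
  apply: bopP => h'; apply: inner_inj => h; rewrite (pairE _ _ _ _ _ _ _ _ hP hQ).
  rewrite bop_sumE inner_sumr.
  under [RHS]eq_bigr => i _ do rewrite bopZE innerZr blockE.
  rewrite (partition_big bl xpredT)//=; apply: eq_bigr => i _.
  rewrite mulr_sumr; apply: eq_bigr => p /eqP pi.
  rewrite (bigD1 p)//= big1 ?addr0 => [|q qp].
    by rewrite hla pi mulrCA.
  by rewrite z0 1?eq_sym// mul0r mulr0.
apply/seteqP; split.
  rewrite {1}SE; apply: closed_span_sub; first exact: closed_span_closed.
  move=> _ [i [xi [eta ->]]].
  have [Jx hJx] := coslice_exists ht xi; have [Je hJe] := coslice_exists ht eta.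
  have hP := adj_coslice ht hJx; have hQ := adj_coslice ht hJe.
  pose a := block_proj bl i \ob adj Jx \ob v.
  pose b := block_proj bl i \ob adj Je \ob v.
  apply: sub_closed_span; exists (adj a); first exists a.
  - apply: sub_closed_span; exists (block_proj bl i), xi, (adj Jx); split=> //.
    exact: block_proj_commutant.
  - exact: adjP.
  exists b.
    apply: sub_closed_span; exists (block_proj bl i), eta, (adj Je); split=> //.
    exact: block_proj_commutant.
  apply: bopP => h'; apply: inner_inj => h; rewrite blockE /= adjr /= inner_l2.
  rewrite [RHS]big_mkcond; apply: eq_bigr => p _.
  rewrite inner_cplx !block_projE (sliceE _ _ hP) (sliceE _ _ hQ) !vE.
  by case: ifP => // _; rewrite mulr0.
apply: closed_span_sub => // _ [_ [a Va /adj_uniq ->] [b Vb <-]].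
(* Close up in one variable at a time. The adjoint is used to exchange the two
   factors, so that only continuity of left multiplication is needed. *)
have h1 a0 : gens a0 -> S (adj a0 \ob b).
  move=> ga; move: b Vb; apply: closed_span_sub.
    exact: (normal_map_preimage (normal_map_compl H (adj a0)) clS).
  by move=> b0 gb; exact: gensS.
rewrite -[_ \ob b]adjK adj_comp adjK; apply: SJ.
move: a Va; apply: closed_span_sub.
  exact: (normal_map_preimage (normal_map_compl H (adj b)) clS).
by move=> a0 ga; rewrite /preimage /= -[a0]adjK -adj_comp; apply: SJ; exact: h1.
Qed.

End Construction.

Theorem theorem5p20 (R : realType) (H : hilbertType R) (M S : set (bop H H))
    (hM : von_neumann M) (hMfin : finite_dim M)
    (hS : quantum_relation M M S) (hSadj : S = adj_set S) :
  [/\ (exists (K : hilbertType R) (N : set (bop K K))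
          (theta : bop K K -> bop H H), arises_from M S N theta)
      <-> (exists x0 : bop H H, dominating M S x0),
      (forall (K : hilbertType R) (N : set (bop K K))
          (theta : bop K K -> bop H H),
        arises_from M S N theta -> dominating M S (theta (bid K))) &
      ((exists (K : hilbertType R) (N : set (bop K K))
          (theta : bop K K -> bop H H), arises_from M S N theta) ->
       exists (K : hilbertType R) (N : set (bop K K))
          (theta : bop K K -> bop H H),
        finite_dim N /\ arises_from M S N theta)].
Proof.
have fwd (K : hilbertType R) (N : set (bop K K)) (theta : bop K K -> bop H H) :
  arises_from M S N theta -> dominating M S (theta (bid K)).
  exact: arises_dominating.
have bwd x0 : dominating M S x0 -> exists (K : hilbertType R) (N : set (bop K K))
    (theta : bop K K -> bop H H), finite_dim N /\ arises_from M S N theta.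
  move=> /(kraus_span hM hMfin hS hSadj)[m [n [g [Mg SE]]]].
  pose gp (r : 'I_m * 'I_n) := g r.1 r.2.
  exists (l2sum ('I_m * 'I_n)%type (cplx R)), (block_diagonal fst), (kraus_map gp).
  split; first exact: block_diagonal_finite.
  apply: (kraus_arises (J := 'I_m)) => //.
  - by move=> p; exact: Mg.
  - by have [] := hS.
  - by move=> x Sx; rewrite hSadj; exists x => //; exact: adjP.
  rewrite {1}SE; congr closed_span; apply/seteqP.
  have e i xi eta : \sum_j rank1 (adj (g i j) xi) (adj (g i j) eta) =
      \sum_(p | p.1 == i) rank1 (adj (gp p) xi) (adj (gp p) eta).
    rewrite (reindex_onto (fun j : 'I_n => (i, j)) snd) /=.
      by apply: eq_bigl => j; rewrite !eqxx.
    by move=> [a b] /= /eqP ->.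
  by split=> x [i [xi [eta ->]]]; exists i, xi, eta.
split=> //.
- split=> [[K [N [theta /fwd h]]]|[x0 /bwd[K [N [theta [_ h]]]]]].
    by exists (theta (bid K)).
  by exists K, N, theta.
- by move=> [K [N [theta /fwd/bwd]]].
Qed.
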